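(* Let $\mathsf{ICom}$ be the symmetric two-coloured operad (colours $A$, $J$; see context) generated by a unary operation $i:J\to A$, a symmetric binary operation $\alpha:A\otimes A\to A$ and a binary operation $r:J\otimes A\to J$ (no symmetry), subject to the relations $$\alpha(\alpha(x_1,x_2),x_3)=\alpha(\alpha(x_1,x_3),x_2)=\alpha(x_1,\alpha(x_2,x_3)),$$ $$r(r(x_1,x_2),x_3)=r(r(x_1,x_3),x_2)=r(x_1,\alpha(x_2,x_3)),$$ $$\alpha(i(x_1),x_2)=i(r(x_1,x_2)),\qquad r(x_1,i(x_2))=r(x_2,i(x_1)).$$ Then the $\Sigma_3$- and $\Sigma_2$-orbits of these quadratic relations constitute a quadratic Gröbner basis of the ideal of relations of the shuffle two-coloured operad associated with $\mathsf{ICom}$, whose generators are $\alpha,i,r$ and $l$, where $l(x_1,x_2)=r(x_2,x_1)$, with respect to the path-lexicographic ordering of tree monomials associated with the ordering $\alpha<i<l<r$ of generators. Moreover, the generating series of dimensions of $\mathsf{ICom}$ (first variable and component: colour $A$; second: colour $J$) are $$\big(F^1_{\mathsf{ICom}}(t_1,t_2);\,F^2_{\mathsf{ICom}}(t_1,t_2)\big)=\big(e^{t_1+t_2}-1;\; e^{t_1+t_2}-e^{t_1}\big).$$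
   Context: Work over a field $\Bbbk$ of characteristic $0$. Let $I$ be a finite set of colours. A symmetric $I$-coloured operad $P$ consists of finite-dimensional spaces $P(n,\chi,c)$ for $n\ge 1$, $\chi:\{1,\dots,n\}\to I$ (input colours), $c\in I$ (output colour), with symmetric group actions $\sigma:P(n,\chi,c)\to P(n,\chi\sigma,c)$, partial compositions $\circ_l$ defined when the colour of the $l$-th input equals the output colour of the inserted operation, and identities $\mathrm{id}_c$, satisfying the usual operad axioms. Generating series: for $I=\{c_1,\dots,c_d\}$, $F^i_P(t_1,\dots,t_d)=\sum_{m_1,\dots,m_d}\frac{\dim P(m_1+\dots+m_d,\chi,c_i)}{m_1!\cdots m_d!}t_1^{m_1}\cdots t_d^{m_d}$, where $\chi$ is any colouring with $|\chi^{-1}(c_j)|=m_j$. Here $c_1=A$, $c_2=J$. Free shuffle coloured operad. Given generators, each with an arity, an ordered list of input colours and an output colour, the free shuffle $I$-coloured operad has as basis the tree monomials: planar rooted trees with vertices labelled by generators, edge colours matching the input/output colours of the generators, and leaves labelled bijectively by $1,\dots,n$ so that at every vertex the smallest leaf labels of the subtrees above its inputs increase from left to right. Shuffle compositions $\alpha\circ_{l,\omega}\beta$ graft $\beta$ on the leaf $l$ of $\alpha$ (colours matching) and relabel the leaves by $\omega$, preserving the relative orders of labels coming from $\alpha$ and from $\beta$, so that the result is again a shuffle tree. An operadic ideal is a subspace (a collection of subspaces, one for each arity, input colouring and output colour) closed under compositions with arbitrary elements on either side. A symmetric operad given by generators and relations yields a shuffle operad: its generators are all generators together with a basis of their symmetric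 group orbits, and its relations are all elements of the symmetric group orbits of the relations, rewritten as combinations of shuffle tree monomials. Path-lexicographic ordering: to a tree monomial with $n$ leaves assign $(a_1,\dots,a_n)$, where $a_j$ is the word of vertex labels on the path from the root to leaf $j$, and the permutation of leaf labels read left to right. To compare two monomials, compare first arities, then the vectors $(a_1,\dots,a_n)$ component by component using the degree-lexicographic order on words (longer words are greater; words of equal length are compared lexicographically), then the permutations in reverse lexicographic order. Gröbner bases: the leading term of an element is its largest tree monomial. For a subtree (containing all edges adjacent to its vertices) of a tree monomial, its leaves are relabelled according to the order of the smallest leaf labels above them; $\alpha$ is divisible by $\beta$ if $\beta$ arises in this way from a subtree of $\alpha$. A generating set $G$ of an operadic ideal $M$ is a Gröbner basis if the leading term of every nonzero $f\in M$ is divisible by the leading term of some element of $G$. It is quadratic if all its elements are combinations of tree monomials with two vertices. *)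

(* Defs.v *)
From HB Require Import structures.
From mathcomp Require Import all_boot all_order all_fingroup all_algebra.
From mathcomp Require Import freeg.

Set Implicit Arguments.
Unset Strict Implicit.
Unset Printing Implicit Defensive.

Import GRing.Theory.
Local Open Scope ring_scope.

Record signature (I : Type) := Signature {
  op :> choiceType;
  inputs : op -> seq I;
  output : op -> I
}.
Arguments inputs {I s}.
Arguments output {I s}.

Unset Elimination Schemes.
Inductive tree (G X : Type) := Leaf of X | Node of G & seq (tree G X).
Set Elimination Schemes.
Arguments Leaf {G X}.
Arguments Node {G X}.

Section TreeInd.
Variables (G X : Type) (P : tree G X -> Prop).
Hypothesis PLeaf : forall x, P (Leaf x).
Hypothesis PNode :
  forall g ts, foldr (fun t Q => P t /\ Q) True ts -> P (Node g ts).

Fixpoint tree_ind t : P t :=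
  match t with
  | Leaf x => PLeaf x
  | Node g ts =>
    let fix loop ts : foldr (fun t Q => P t /\ Q) True ts :=
      if ts is t' :: ts' then conj (tree_ind t') (loop ts') else I in
    PNode g (loop ts)
  end.
End TreeInd.

Section TreeChoice.
Variables G X : Type.

Fixpoint tree_encode (t : tree G X) : GenTree.tree (G + X) :=
  match t with
  | Leaf x => GenTree.Leaf (inr x)
  | Node g ts => GenTree.Node 0 (GenTree.Leaf (inl g) :: map tree_encode ts)
  end.

Fixpoint tree_decode (t : GenTree.tree (G + X)) : option (tree G X) :=
  match t with
  | GenTree.Leaf (inr x) => Some (Leaf x)
  | GenTree.Node _ (GenTree.Leaf (inl g) :: ts) =>
      Some (Node g (pmap tree_decode ts))
  | _ => None
  end.

Lemma tree_encodeK : pcancel tree_encode tree_decode.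
Proof.
elim=> //= g ts IH; congr (Some (Node g _)).
by elim: ts IH => //= t ts IHts [-> /IHts] /= ->.
Qed.
End TreeChoice.

HB.instance Definition _ (G X : choiceType) :=
  Choice.copy (tree G X) (pcan_type (@tree_encodeK G X)).

Section Trees.
Variable G : eqType.

Fixpoint leaves X (t : tree G X) : seq X :=
  match t with
  | Leaf x => [:: x]
  | Node _ ts => flatten (map (@leaves X) ts)
  end.

Fixpoint nvertices X (t : tree G X) : nat :=
  match t with
  | Leaf _ => 0
  | Node _ ts => (sumn (map (@nvertices X) ts)).+1
  end.

Fixpoint graft X Y (f : X -> tree G Y) (t : tree G X) : tree G Y :=
  match t with
  | Leaf x => f x
  | Node g ts => Node g (map (graft f) ts)
  end.

Definition relabel X Y (f : X -> Y) : tree G X -> tree G Y :=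
  graft (fun x => Leaf (f x)).

Fixpoint branches X (t : tree G X) : seq (tree G X) :=
  t :: (if t is Node _ ts then flatten (map (@branches X) ts) else [::]).

(** The word of vertex labels on the path from the root to the leaf [x]; when
    leaf labels are distinct, at most one summand of [flatten] is nonempty. *)
Fixpoint path_word (X : eqType) (x : X) (t : tree G X) : seq G :=
  match t with
  | Leaf _ => [::]
  | Node g ts =>
    g :: flatten [seq (if x \in leaves s then path_word x s else [::]) | s <- ts]
  end.

(** Leaf labels are numbered from 0; [n] is larger than all of them. *)
Definition min_leaf n (t : tree G 'I_n) : nat :=
  foldr minn n (map val (leaves t)).

Fixpoint increasing n (t : tree G 'I_n) : bool :=
  match t with
  | Leaf _ => true
  | Node _ ts => sorted ltn (map (@min_leaf n) ts) && all (@increasing n) ts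
  end.

(** [comp_tree l u v s t] grafts [t] on the leaf [l] of [s], the other leaves
    of [s] being relabelled by [u] and those of [t] by [v]. *)
Definition comp_tree n m N (l : 'I_n) (u : 'I_n -> 'I_N) (v : 'I_m -> 'I_N)
    (s : tree G 'I_n) (t : tree G 'I_m) : tree G 'I_N :=
  graft (fun i => if i == l then relabel v t else Leaf (u i)) s.

End Trees.

Section ColouredTrees.
Variables (I : eqType) (S : signature I).

Fixpoint well_coloured X (chi : X -> I) (t : tree S X) (c : I) : bool :=
  match t with
  | Leaf x => chi x == c
  | Node g ts =>
    (output g == c) && all2 (well_coloured chi) ts (inputs g)
  end.

(** Basis of the free symmetric operad on the free symmetric collection
    spanned by [S]: each input [x_0, ..., x_(n-1)] is used exactly once. *)
Definition sym_monomial n (chi : {ffun 'I_n -> I}) (c : I)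
    (t : tree S 'I_n) : bool :=
  well_coloured chi t c && perm_eq (leaves t) (enum 'I_n).

Definition shuffle_monomial n (chi : {ffun 'I_n -> I}) (c : I)
    (t : tree S 'I_n) : bool :=
  sym_monomial chi c t && increasing t.

End ColouredTrees.

Section Operads.
Variables (K : fieldType) (I : eqType) (S : signature I).

Definition elt n := {freeg (tree S 'I_n) / K}.

(** A subset of the component [(n, chi, c)], for all [n], [chi] and [c]. *)
Definition family :=
  forall n : nat, {ffun 'I_n -> I} -> I -> elt n -> Prop.

Definition free_sym : family := fun n chi c f =>
  all (sym_monomial chi c) (dom f).

Definition free_shuffle : family := fun n chi c f =>
  all (shuffle_monomial chi c) (dom f).

Definition relabel_elt n m (h : 'I_n -> 'I_m) (f : elt n) : elt m :=
  fglift (fun t => << relabel h t >>) f.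

Definition comp_elt n m N (l : 'I_n) (u : 'I_n -> 'I_N) (v : 'I_m -> 'I_N)
    (f : elt n) (g : elt m) : elt N :=
  fglift (fun s => fglift (fun t => << comp_tree l u v s t >>) g) f.

(** [sigma : P(n, chi, c) -> P(n, chi sigma, c)]: the [i]-th input of the
    result is the [sigma i]-th input of [f]. *)
Definition perm_colouring n (sigma : 'S_n) (chi : {ffun 'I_n -> I}) :
  {ffun 'I_n -> I} := [ffun i => chi (sigma i)].

Definition sym_act n (sigma : 'S_n) (f : elt n) : elt n :=
  relabel_elt (fun i => (sigma^-1)%g i) f.

(** The labellings for which [comp_elt] is the partial composition at [l]:
    the inputs of the inserted operation become the inputs [l, ..., l + m]. *)
Definition outer_label n m (l i : 'I_n.+1) : 'I_(n + m).+1 :=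
  inord (if (i < l)%N then i : nat else i + m)%N.
Definition inner_label n m (l : 'I_n.+1) (j : 'I_m.+1) : 'I_(n + m).+1 :=
  inord (l + j)%N.

(** Shuffle labellings: both sets of labels keep their relative order, the leaf
    [l] of the lower tree being represented by the smallest leaf of the tree
    grafted on it. *)
Definition is_shuffle n m (l : 'I_n.+1) (u : 'I_n.+1 -> 'I_(n + m).+1)
    (v : 'I_m.+1 -> 'I_(n + m).+1) : Prop :=
  [/\ {homo u : i j / (i < j)%N}, {homo v : i j / (i < j)%N}, u l = v ord0 &
      forall k, (k \in codom u) || (k \in codom v)].

Definition comp_colouring n m N (l : 'I_n) (u : 'I_n -> 'I_N)
    (v : 'I_m -> 'I_N) (chi : {ffun 'I_n -> I}) (psi : {ffun 'I_m -> I})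
    (omega : {ffun 'I_N -> I}) : Prop :=
  (forall i, i != l -> omega (u i) = chi i) /\
  (forall j, omega (v j) = psi j).

Definition comp_closed (F M : family)
    (labelling : forall n m, 'I_n.+1 -> ('I_n.+1 -> 'I_(n + m).+1) ->
                             ('I_m.+1 -> 'I_(n + m).+1) -> Prop) : Prop :=
  forall n m (l : 'I_n.+1) u v (chi : {ffun 'I_n.+1 -> I})
    (psi : {ffun 'I_m.+1 -> I}) omega c f g,
  labelling n m l u v -> comp_colouring l u v chi psi omega ->
  (M n.+1 chi c f /\ F m.+1 psi (chi l) g) \/
  (F n.+1 chi c f /\ M m.+1 psi (chi l) g) ->
  M (n + m).+1 omega c (comp_elt l u v f g).

Definition subspaces (F M : family) : Prop :=
  forall n chi c,
  [/\ forall f, M n chi c f -> F n chi c f,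
      M n chi c 0 &
      forall (a : K) f g, M n chi c f -> M n chi c g -> M n chi c (a *: f + g)].

Definition is_sym_ideal (M : family) : Prop :=
  [/\ subspaces free_sym M,
      forall n (sigma : 'S_n) chi c f,
        M n chi c f -> M n (perm_colouring sigma chi) c (sym_act sigma f) &
      comp_closed free_sym M (fun n m l u v =>
        u = outer_label m l /\ v = inner_label l)].

Definition is_shuffle_ideal (M : family) : Prop :=
  subspaces free_shuffle M /\ comp_closed free_shuffle M is_shuffle.

Definition generated_by (ideal : family -> Prop) (R : family) : family :=
  fun n chi c f => forall M, ideal M ->
    (forall k psi d g, R k psi d g -> M k psi d g) -> M n chi c f.

(** [quotient_dim V W d]: the quotient of the space [V] by its subspace [W] has
    a basis with [d] elements. *)
Definition quotient_dim n (V W : elt n -> Prop) (d : nat) : Prop :=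
  exists e : 'I_d -> elt n,
  [/\ forall i, V (e i),
      forall f, V f -> exists a : 'I_d -> K, W (f - \sum_i a i *: e i) &
      forall a : 'I_d -> K, W (\sum_i a i *: e i) -> forall i, a i = 0].

Section Groebner.
Variable opr_lt : rel S.

Fixpoint lex_lt (T : eqType) (lt : rel T) (s1 s2 : seq T) : bool :=
  match s1, s2 with
  | x1 :: s1', x2 :: s2' => lt x1 x2 || (x1 == x2) && lex_lt lt s1' s2'
  | [::], _ :: _ => true
  | _, [::] => false
  end.

Definition deglex_lt : rel (seq S) := fun w1 w2 =>
  (size w1 < size w2)%N || (size w1 == size w2) && lex_lt opr_lt w1 w2.

Definition path_vector n (t : tree S 'I_n) : seq (seq S) :=
  [seq path_word j t | j <- enum 'I_n].

(** Path-lexicographic order on the monomials with [n] leaves (elements are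
    homogeneous, so arities never need comparing).  Ties are broken by the
    opposite of the lexicographic order of permutations. *)
Definition path_lex_lt n : rel (tree S 'I_n) := fun s t =>
  lex_lt deglex_lt (path_vector s) (path_vector t) ||
  (path_vector s == path_vector t) &&
    lex_lt (fun i j : 'I_n => (i < j)%N) (leaves t) (leaves s).

Definition leading n (f : elt n) (t : tree S 'I_n) : Prop :=
  t \in dom f /\ forall s, s \in dom f -> s != t -> path_lex_lt s t.

(** [t] is divisible by [s]: the subtree of [t] isomorphic to [s] is cut out of
    the branch [graft tau s], and the leaf [i] of [s] stands for the branch
    [tau i]. *)
Definition divides k n (psi : {ffun 'I_k -> I}) (chi : {ffun 'I_n -> I})
    (s : tree S 'I_k) (t : tree S 'I_n) : Prop :=
  exists tau : 'I_k -> tree S 'I_n,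
  [/\ graft tau s \in branches t,
      forall i, well_coloured chi (tau i) (psi i) &
      forall i j : 'I_k, (i < j)%N -> (min_leaf (tau i) < min_leaf (tau j))%N].

Definition is_groebner_basis (M G : family) : Prop :=
  (forall n chi c f, M n chi c f <-> generated_by is_shuffle_ideal G chi c f) /\
  (forall n chi c (f : elt n), M n chi c f -> f != 0 ->
   exists2 t, leading f t &
   exists k psi d g s,
     [/\ G k psi d g, leading g s & divides psi chi s t]).

Definition is_quadratic (G : family) : Prop :=
  forall n chi c f, G n chi c f ->
  all (fun t => nvertices t == 2) (dom f).

End Groebner.
End Operads.

Inductive colour := A | J.

Definition bool_of_colour c := if c is A then true else false.
Definition colour_of_bool (b : bool) := if b then A else J.
Lemma bool_of_colourK : cancel bool_of_colour colour_of_bool.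
Proof. by case. Qed.
HB.instance Definition _ := Finite.copy colour (can_type bool_of_colourK).

Inductive icom_op := OpAlpha | OpI | OpR.

Definition icom_code g : nat :=
  match g with OpAlpha => 0 | OpI => 1 | OpR => 2 end.
Definition icom_decode k : icom_op :=
  match k with 0 => OpAlpha | 1 => OpI | _ => OpR end.
Lemma icom_codeK : cancel icom_code icom_decode.
Proof. by case. Qed.
HB.instance Definition _ := Choice.copy icom_op (can_type icom_codeK).

Definition icom_sig : signature colour := {|
  op := icom_op;
  inputs g := match g with
              | OpAlpha => [:: A; A] | OpI => [:: J] | OpR => [:: J; A]
              end;
  output g := match g with OpAlpha | OpI => A | OpR => J end
|}.

Section ICom.
Variable K : fieldType.

Local Notation alpha s t := (Node (OpAlpha : icom_sig) [:: s; t]).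
Local Notation i_ s := (Node (OpI : icom_sig) [:: s]).
Local Notation r s t := (Node (OpR : icom_sig) [:: s; t]).
Local Notation x1 n := (Leaf (@Ordinal n 0 isT)).
Local Notation x2 n := (Leaf (@Ordinal n 1 isT)).
Local Notation x3 n := (Leaf (@Ordinal n 2 isT)).

Definition all_A n : {ffun 'I_n -> colour} := [ffun=> A].
Definition all_J n : {ffun 'I_n -> colour} := [ffun=> J].
Definition first_J n : {ffun 'I_n -> colour} :=
  [ffun k : 'I_n => if k == 0%N :> nat then J else A].

Inductive icom_relation : family K icom_sig :=
| rel_alpha_comm : icom_relation (all_A 3) A
    (<< alpha (alpha (x1 3) (x2 3)) (x3 3) >>
     - << alpha (alpha (x1 3) (x3 3)) (x2 3) >>)
| rel_alpha_assoc : icom_relation (all_A 3) A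
    (<< alpha (alpha (x1 3) (x3 3)) (x2 3) >>
     - << alpha (x1 3) (alpha (x2 3) (x3 3)) >>)
| rel_r_comm : icom_relation (first_J 3) J
    (<< r (r (x1 3) (x2 3)) (x3 3) >>
     - << r (r (x1 3) (x3 3)) (x2 3) >>)
| rel_r_assoc : icom_relation (first_J 3) J
    (<< r (r (x1 3) (x3 3)) (x2 3) >>
     - << r (x1 3) (alpha (x2 3) (x3 3)) >>)
| rel_alpha_i : icom_relation (first_J 2) A
    (<< alpha (i_ (x1 2)) (x2 2) >> - << i_ (r (x1 2) (x2 2)) >>)
| rel_r_i : icom_relation (all_J 2) J
    (<< r (x1 2) (i_ (x2 2)) >> - << r (x2 2) (i_ (x1 2)) >>).

Inductive alpha_symmetry : family K icom_sig :=
| alpha_sym : alpha_symmetry (all_A 2) A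
    (<< alpha (x1 2) (x2 2) >> - << alpha (x2 2) (x1 2) >>).

(** ICom is [free_sym] modulo [icom_ideal]; the symmetry of the generator
    [alpha] is imposed here as well, since the generators of [free_sym] have no
    symmetry. *)
Definition icom_ideal : family K icom_sig :=
  generated_by (@is_sym_ideal K _ icom_sig) (fun n chi c f =>
    alpha_symmetry chi c f \/ icom_relation chi c f).

Definition icom_dim n (chi : {ffun 'I_n -> colour}) (c : colour) (d : nat) :=
  quotient_dim (@free_sym K _ icom_sig n chi c) (@icom_ideal n chi c) d.

End ICom.

(** [ShL] stands for [l(x_1, x_2) = r(x_2, x_1)]. *)
Inductive shuffle_op := ShAlpha | ShI | ShL | ShR.

(** Also the order [alpha < i < l < r]. *)
Definition shuffle_code g : nat :=
  match g with ShAlpha => 0 | ShI => 1 | ShL => 2 | ShR => 3 end.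
Definition shuffle_decode k : shuffle_op :=
  match k with 0 => ShAlpha | 1 => ShI | 2 => ShL | _ => ShR end.
Lemma shuffle_codeK : cancel shuffle_code shuffle_decode.
Proof. by case. Qed.
HB.instance Definition _ := Choice.copy shuffle_op (can_type shuffle_codeK).

Definition shuffle_sig : signature colour := {|
  op := shuffle_op;
  inputs g := match g with
              | ShAlpha => [:: A; A] | ShI => [:: J]
              | ShL => [:: A; J] | ShR => [:: J; A]
              end;
  output g := match g with ShAlpha | ShI => A | ShL | ShR => J end
|}.

Definition shuffle_op_lt : rel shuffle_sig :=
  fun g h => (shuffle_code g < shuffle_code h)%N.

(** Rewrite a monomial in [alpha], [i], [r] as a shuffle tree monomial.  In a
    well-coloured tree the last case only concerns [i]. *)
Fixpoint to_shuffle n (t : tree icom_sig 'I_n) : tree shuffle_sig 'I_n :=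
  match t with
  | Leaf x => Leaf x
  | Node g ts =>
    match g, map (@to_shuffle n) ts with
    | OpAlpha, [:: s1; s2] =>
        Node (ShAlpha : shuffle_sig)
             (if (min_leaf s1 < min_leaf s2)%N then [:: s1; s2] else [:: s2; s1])
    | OpR, [:: s1; s2] =>
        if (min_leaf s1 < min_leaf s2)%N
        then Node (ShR : shuffle_sig) [:: s1; s2]
        else Node (ShL : shuffle_sig) [:: s2; s1]
    | _, ss => Node (ShI : shuffle_sig) ss
    end
  end.

Section ShuffleICom.
Variable K : fieldType.

Definition to_shuffle_elt n (f : elt K icom_sig n) : elt K shuffle_sig n :=
  fglift (fun t => << to_shuffle t >>) f.

Definition shuffle_icom_relation : family K shuffle_sig :=
  fun n chi c f => exists (chi0 : {ffun 'I_n -> colour}) f0 (sigma : 'S_n),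
  [/\ icom_relation chi0 c f0, chi = perm_colouring sigma chi0 &
      f = to_shuffle_elt (sym_act sigma f0)].

Definition shuffle_icom_ideal : family K shuffle_sig :=
  generated_by (@is_shuffle_ideal K _ shuffle_sig) shuffle_icom_relation.

End ShuffleICom.

(** [F m1 m2] is the coefficient of [t1 ^ m1 * t2 ^ m2]. *)
Definition fps2 := nat -> nat -> rat.

(** The dimension of a component depends only on the numbers of inputs of each
    colour, which is part of this statement. *)
Definition has_gen_series
    (dim : forall n, {ffun 'I_n -> colour} -> colour -> nat -> Prop)
    (c : colour) (F : fps2) : Prop :=
  forall n (chi : {ffun 'I_n -> colour}),
  let m1 := #|[set k | chi k == A]| in
  let m2 := #|[set k | chi k == J]| in
  exists2 d, dim n chi c d & F m1 m2 = d%:R / (m1`! * m2`!)%:R.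

(** Polynomials in [t1] and [t2]: [t1] is the inner variable. *)
Definition t1 : {poly {poly rat}} := ('X)%:P.
Definition t2 : {poly {poly rat}} := 'X.

Definition fps_of_poly (p : {poly {poly rat}}) : fps2 := fun m1 m2 => p`_m2`_m1.

(** The exponential of a polynomial [p] without constant term: terms of total
    degree [m1 + m2] only occur in [p ^+ k] for [k <= m1 + m2]. *)
Definition fps_exp (p : {poly {poly rat}}) : fps2 := fun m1 m2 =>
  \sum_(k < (m1 + m2).+1) fps_of_poly (p ^+ k) m1 m2 / k`!%:R.

Definition fps_sub (F G : fps2) : fps2 := fun m1 m2 => F m1 m2 - G m1 m2.

(* Main.v *)
(** All relations are differences of two monomials, so the sum of coefficients
    vanishes on the ideals, both symmetric and shuffle.

    Groebner basis.  A shuffle monomial divisible by no leading monomial of the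
    relations is forced to be a right comb: every left child is a leaf, or [i]
    applied to a leaf.  There is one such comb for each colouring and output
    colour, and comparing the path words of the smallest leaf, then recursing,
    shows that it is the smallest monomial of its component.  An element of the
    ideal with an irreducible leading monomial would therefore be a multiple of
    a single monomial, and its coefficient sum would not vanish.

    Dimensions.  Modulo the symmetric ideal every monomial is congruent to a
    right comb, and right combs with the same leaves are congruent, so a
    component with a monomial has dimension 1, the coefficient sum being the
    isomorphism with the ground field. *)

From HB Require Import structures.
Require Import Defs.
From mathcomp Require Import all_boot all_order all_fingroup all_algebra.
From mathcomp Require Import freeg zify ring.

Set Implicit Arguments.
Unset Strict Implicit.
Unset Printing Implicit Defensive.

Import GRing.Theory.
Local Open Scope ring_scope.

(** * Linear combinations *)

(** No S-polynomial is reduced: the kernel of the coefficient sum bounds the shuffle ideal from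
    above, and this bound alone rules out irreducible leading monomials. In the comparison with the
    comb, a left child that is too large lengthens the word of the smallest leaf; the exception is a
    root [i], where the lengths may agree and [alpha < i] decides.

    The dimensions are found in the symmetric operad itself, so its quotient is never compared with
    the shuffle one. The obstacle there is that the ideal axioms know only the labels ['I_n] and
    compositions inserting a consecutive block of inputs, whereas a subtree of a monomial carries an
    arbitrary set of labels. Hence the congruence [eqv] on trees over any label type, defined
    through all numberings of the leaves: rewriting inside a tree becomes the substitution of
    congruent trees for leaves. *)

Section FreegLinear.
Variables (K : fieldType) (T : choiceType) (M : lmodType K) (F : T -> M).

Lemma fglift_linear : linear (fglift F).
Proof.
move=> a f g.
have addF := lift_is_additive F.
have addFD u v : fglift F (u + v) = fglift F u + fglift F v.
  (* [addF] speaks of differences, so the sum is read as [u - (0 - v)], and [0] as [0 - 0]. *)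
  by rewrite -[v]opprK addF -[- v]sub0r addF -[0]subr0 !addF !subrr !sub0r !opprK.
have sumF (I : Type) (r : seq I) (h : I -> {freeg T / K}) :
    fglift F (\sum_(i <- r) h i) = \sum_(i <- r) fglift F (h i).
  elim: r => [|i r IH]; last by rewrite !big_cons addFD IH.
  by rewrite !big_nil -[0]subr0 addF subrr.
rewrite addFD; congr (_ + _).
rewrite -{2}[f]freeg_sumE sumF scaler_sumr [a *: f]/(fgscale a f) sumF.
by apply: eq_bigr => x _; rewrite !liftU scalerA.
Qed.

HB.instance Definition _ :=
  GRing.isLinear.Build K {freeg T / K} M _ (fglift F) fglift_linear.

Lemma fgliftB f g : fglift F (f - g) = fglift F f - fglift F g.
Proof. exact: raddfB. Qed.

Lemma fgliftU x : fglift F << x >> = F x.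
Proof. by rewrite liftU scale1r. Qed.

Lemma fgliftE f : fglift F f = \sum_(x <- dom f) coeff x f *: F x.
Proof.
rewrite -{1}[f]freeg_sumE linear_sum; apply: eq_bigr => x _.
exact: liftU.
Qed.

End FreegLinear.

Section Support.
Variables (K : fieldType) (T : choiceType).
Implicit Types (f g : {freeg T / K}) (P : pred T).

Lemma freegZU (a : K) (x : T) : a *: << x >> = << a *g x >> :> {freeg T / K}.
Proof.
by apply/eqP/freeg_eqP => y; rewrite coeffZ !coeffU mul1r.
Qed.

Lemma freeg_span f : f = \sum_(x <- dom f) coeff x f *: << x >>.
Proof.
by rewrite -{1}[f]freeg_sumE; apply: eq_bigr => x _; rewrite freegZU.
Qed.

Lemma all_dom0 P : all P (dom (0 : {freeg T / K})).
Proof. by rewrite dom0. Qed.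

Lemma all_domU P x : all P (dom (<< x >> : {freeg T / K})) = P x.
Proof. by rewrite domU1 /= andbT. Qed.

Lemma all_domD P f g : all P (dom f) -> all P (dom g) -> all P (dom (f + g)).
Proof.
move=> /allP Pf /allP Pg; apply/allP => x /domD_subset.
by rewrite mem_cat => /orP[/Pf|/Pg].
Qed.

Lemma all_domZ P a f : all P (dom f) -> all P (dom (a *: f)).
Proof. by move=> /allP Pf; apply/allP => x /domZ_subset /Pf. Qed.

Lemma all_domN P f : all P (dom f) -> all P (dom (- f)).
Proof. by rewrite -scaleN1r; apply: all_domZ. Qed.

Lemma all_dom_sum (I : eqType) (r : seq I) P (F : I -> {freeg T / K}) :
  (forall i, i \in r -> all P (dom (F i))) -> all P (dom (\sum_(i <- r) F i)).
Proof.
move=> PF; rewrite big_seq; elim/big_rec: _ => [|i x ri IH].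
  exact: all_dom0.
by apply: all_domD => //; apply: PF.
Qed.

Lemma all_dom_eq0 P f : (forall x, ~~ P x) -> all P (dom f) -> f = 0.
Proof.
move=> nP /allP Pf; apply/eqP; rewrite -dom_eq0.
by case: (dom f) Pf => // x s /(_ x (mem_head _ _)); rewrite (negPf (nP x)).
Qed.

Lemma domBU x y : {subset dom (<< x >> - << y >> : {freeg T / K}) <= [:: x; y]}.
Proof. by move=> z /domB; rewrite !domU1. Qed.

Lemma domBU1 x y : x != y -> x \in dom (<< x >> - << y >> : {freeg T / K}).
Proof.
move=> xy; rewrite mem_dom coeffB !coeffU eqxx [y == x]eq_sym (negPf xy).
by rewrite mulr0 subr0 mulr1 oner_eq0.
Qed.

Lemma domBU2 x y : x != y -> y \in dom (<< x >> - << y >> : {freeg T / K}).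
Proof.
move=> xy; rewrite mem_dom coeffB !coeffU eqxx (negPf xy).
by rewrite mulr0 sub0r mulr1 oppr_eq0 oner_eq0.
Qed.

Definition coeff_sum f : K := fglift (fun=> 1 : K^o) f.

Lemma coeff_sum_is_linear : linear (coeff_sum : {freeg T / K} -> K^o).
Proof. exact: fglift_linear. Qed.

HB.instance Definition _ :=
  GRing.isLinear.Build K {freeg T / K} K^o _ (coeff_sum : {freeg T / K} -> K^o)
    coeff_sum_is_linear.

Lemma coeff_sumU x : coeff_sum << x >> = 1.
Proof. by rewrite /coeff_sum fgliftU. Qed.

Lemma coeff_sumBU x y : coeff_sum (<< x >> - << y >>) = 0.
Proof. by rewrite raddfB /= !coeff_sumU subrr. Qed.

(** Moving the whole coefficient sum onto one monomial costs a combination of differences of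
    monomials; this is how a component is shown to be spanned by [x] modulo the ideal. *)
Lemma coeff_sum_sub f x (a : K) :
  coeff_sum f = a -> f - a *: << x >> =
    \sum_(y <- dom f) coeff y f *: (<< y >> - << x >>).
Proof.
move=> <-; rewrite /coeff_sum fgliftE scaler_suml {1}[f]freeg_span -sumrB.
by apply: eq_bigr => y _; rewrite scalerBr -scalerA scale1r.
Qed.

End Support.

Lemma eq_fglift (K : fieldType) (T : choiceType) (M : lmodType K) (F F' : T -> M) f :
  F =1 F' -> fglift F f = fglift F' f.
Proof. by move=> FF'; rewrite !fgliftE; apply: eq_bigr => x _; rewrite FF'. Qed.

Lemma fglift_comp (K : fieldType) (T U : choiceType) (M : lmodType K)
    (F : T -> {freeg U / K}) (F' : U -> M) f :
  fglift F' (fglift F f) = fglift (fun x => fglift F' (F x)) f.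
Proof.
rewrite (fgliftE F) [RHS]fgliftE linear_sum; apply: eq_bigr => x _.
by rewrite linearZ.
Qed.

Lemma all_dom_fglift (K : fieldType) (T U : choiceType) (P : pred U)
    (F : T -> {freeg U / K}) f :
  (forall x, x \in dom f -> all P (dom (F x))) -> all P (dom (fglift F f)).
Proof.
move=> PF; rewrite fgliftE; apply: all_dom_sum => x xf.
by apply: all_domZ; apply: PF.
Qed.

Lemma coeff_sum_fglift (K : fieldType) (T U : choiceType)
    (F : T -> {freeg U / K}) f a :
  (forall x, x \in dom f -> coeff_sum (F x) = a) ->
  coeff_sum (fglift F f) = a * coeff_sum f.
Proof.
move=> aF; rewrite fgliftE raddf_sum /coeff_sum [in RHS]fgliftE mulr_sumr.
rewrite !big_seq; apply: eq_bigr => x /aF <-.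
by rewrite -[LHS]/(coeff_sum _) linearZ /= mulrC -mulrA mul1r.
Qed.

(** * Grafting and colourings *)

Section GraftTheory.
Variable G : eqType.

Lemma leaves_graft X Y (f : X -> tree G Y) (t : tree G X) :
  leaves (graft f t) = flatten [seq leaves (f x) | x <- leaves t].
Proof.
elim: t => [x|g ts IH] /=; first by rewrite cats0.
by elim: ts IH => //= t ts IHts [-> /IHts ->]; rewrite map_cat flatten_cat.
Qed.

Lemma leaves_relabel X Y (f : X -> Y) (t : tree G X) :
  leaves (relabel f t) = map f (leaves t).
Proof.
by rewrite leaves_graft; elim: (leaves t) => //= x s ->.
Qed.

Lemma graft_graft X Y Z (f : X -> tree G Y) (h : Y -> tree G Z) t :
  graft h (graft f t) = graft (fun x => graft h (f x)) t.
Proof.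
elim: t => //= g ts IH; congr (Node g _).
by elim: ts IH => //= t ts IHts [-> /IHts ->].
Qed.

Lemma eq_in_graft (X : eqType) Y (f h : X -> tree G Y) t :
  {in leaves t, f =1 h} -> graft f t = graft h t.
Proof.
elim: t => [x fh|g ts IH] /=; first by apply: fh; rewrite inE.
move=> fh; congr (Node g _).
elim: ts IH fh => //= t ts IHts [IHt /IHts IH] fh.
rewrite IHt => [|x xt]; last by apply: fh; rewrite mem_cat xt.
by rewrite IH // => x xt; apply: fh; rewrite mem_cat xt orbT.
Qed.

Lemma graft_Leaf X (t : tree G X) : graft Leaf t = t.
Proof.
elim: t => //= g ts IH; congr (Node g _).
by elim: ts IH => //= t ts IHts [-> /IHts ->].
Qed.

Lemma relabel_comp X Y Z (f : X -> Y) (h : Y -> Z) (t : tree G X) :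
  relabel h (relabel f t) = relabel (h \o f) t.
Proof. exact: graft_graft. Qed.

Lemma relabel_id (X : eqType) (f : X -> X) (t : tree G X) :
  {in leaves t, f =1 id} -> relabel f t = t.
Proof.
by move=> fid; rewrite -[RHS]graft_Leaf; apply: eq_in_graft => x /fid /= ->.
Qed.

Lemma relabel_lift (X : eqType) Y (h : X -> Y) (t : tree G Y) :
  (forall y, List.In y (leaves t) -> exists x, h x = y) ->
  exists t', relabel h t' = t.
Proof.
elim: t => [y|g ts IH] ht.
  by have [|x hx] := ht y; [left|exists (Leaf x); rewrite /relabel /= hx].
suff [ts' <-] : exists ts', map (relabel h) ts' = ts by exists (Node g ts').
elim: ts IH ht => [|t ts IHts] /=; first by exists [::].
move=> [IHt /IHts IH] ht.
have [|t' <-] := IHt; first by move=> y yt; apply: ht; apply/List.in_or_app; left.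
have [|ts' <-] := IH; first by move=> y yt; apply: ht; apply/List.in_or_app; right.
by exists (t' :: ts').
Qed.

End GraftTheory.

Section ColouredGraft.
Variables (I : eqType) (S : signature I).

Lemma eq_in_well_coloured (X : eqType) (chi psi : X -> I) (t : tree S X) c :
  {in leaves t, chi =1 psi} -> well_coloured chi t c = well_coloured psi t c.
Proof.
elim: t c => [x|g ts IH] c /= E; first by rewrite E ?inE.
congr (_ && _); elim: ts (inputs g) IH E => [|t ts IHts] [|d ds] //= [IHt /IHts IH] E.
rewrite IHt => [|x xt]; last by apply: E; rewrite mem_cat xt.
by rewrite IH // => x xt; apply: E; rewrite mem_cat xt orbT.
Qed.

Lemma well_coloured_graft (X : eqType) Y (chi : X -> I) (psi : Y -> I) f
    (t : tree S X) c :
  (forall x, x \in leaves t -> well_coloured psi (f x) (chi x)) ->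
  well_coloured chi t c -> well_coloured psi (graft f t) c.
Proof.
elim: t c => [x|g ts IH] c /= E; first by move/eqP <-; apply: E; rewrite inE.
move=> /andP[-> /=]; elim: ts (inputs g) IH E => [|t ts IHts] [|d ds] //=.
move=> [IHt /IHts IH] E /andP[td tds]; rewrite IHt // => [|x xt].
  by rewrite IH // => x xt; apply: E; rewrite mem_cat xt orbT.
by apply: E; rewrite mem_cat xt.
Qed.

Lemma well_coloured_graft_inv (X : eqType) Y (chi : X -> I) (psi : Y -> I) f
    (t : tree S X) c :
  well_coloured chi t c -> well_coloured psi (graft f t) c ->
  forall x, x \in leaves t -> well_coloured psi (f x) (chi x).
Proof.
elim: t c => [x|g ts IH] c /=.
  by move=> /eqP <- fx y; rewrite inE => /eqP ->.
move=> /andP[_ +] /andP[_ +].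
elim: ts (inputs g) IH => [|t ts IHts] [|d ds] //= [IHt /IHts IH].
move=> /andP[td tds] /andP[ftd ftds] x; rewrite mem_cat => /orP[].
  exact: IHt td ftd x.
exact: IH tds ftds x.
Qed.

Lemma well_coloured_relabel X Y (h : X -> Y) (chi : Y -> I) (t : tree S X) c :
  well_coloured chi (relabel h t) c = well_coloured (chi \o h) t c.
Proof.
elim: t c => // g ts IH c /=; congr (_ && _).
by elim: ts (inputs g) IH => [|t ts IHts] [|d ds] //= [-> /IHts ->].
Qed.

Hypothesis inputs_neq0 : forall g : S, inputs g != [::].

Lemma size_leaves_gt0 X (chi : X -> I) (t : tree S X) c :
  well_coloured chi t c -> (0 < size (leaves t))%N.
Proof.
elim: t c => // g ts IH c /= /andP[_]; move: (inputs_neq0 g).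
case: (inputs g) ts IH => [|d ds] [|t ts] //= [IH _] _ /andP[/IH].
by rewrite size_cat; case: (leaves t).
Qed.

End ColouredGraft.

(** * Smallest leaf labels *)

Section MinLeaf.
Variable G : eqType.

Lemma foldr_minn_le n (s : seq nat) x : x \in s -> (foldr minn n s <= x)%N.
Proof.
elim: s => // y s IH; rewrite inE /= => /orP[/eqP ->|/IH]; first exact: geq_minl.
by apply: leq_trans; exact: geq_minr.
Qed.

Lemma foldr_minn_mem n (s : seq nat) :
  s != [::] -> all (fun x => x < n)%N s -> foldr minn n s \in s.
Proof.
elim: s => // y s IH _ /= /andP[yn sn]; rewrite inE /minn.
case: ifP => [_|/negbT]; first by rewrite eqxx.
case: s IH sn => [|z s] IH sn; first by rewrite /= yn.
by rewrite IH ?orbT.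
Qed.

Lemma min_leaf_le n (t : tree G 'I_n) i : i \in leaves t -> (min_leaf t <= i)%N.
Proof. by move=> it; apply/foldr_minn_le/map_f. Qed.

Lemma min_leaf_mem n (t : tree G 'I_n) :
  (0 < size (leaves t))%N -> exists2 i, i \in leaves t & min_leaf t = i.
Proof.
move=> t0; have : min_leaf t \in map val (leaves t).
  apply: foldr_minn_mem; first by case: (leaves t) t0.
  by apply/allP => x /mapP[i _ ->]; apply: (valP i).
by case/mapP => i it ->; exists i.
Qed.

Lemma min_leafE n (t : tree G 'I_n) i :
  i \in leaves t -> (forall j, j \in leaves t -> (i <= j)%N) ->
  min_leaf t = i.
Proof.
move=> it ile; apply/eqP; rewrite eqn_leq min_leaf_le //=.
case: (@min_leaf_mem n t) => [|j jt ->]; last exact: ile.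
by case: (leaves t) it.
Qed.

End MinLeaf.

(** * Compositions and coefficient sums *)

Section Labellings.

(* The label [u l] is irrelevant, since the leaf [l] is replaced by a tree. *)
Definition bijective_labelling n m N (l : 'I_n) (u : 'I_n -> 'I_N)
    (v : 'I_m -> 'I_N) :=
  perm_eq (map v (enum 'I_m) ++ map u (rem l (enum 'I_n))) (enum 'I_N).

(** The list has exactly [(n + m).+1] entries, so covering all labels already excludes
    repetitions. *)
Lemma bijective_labellingP n m (l : 'I_n.+1) (u : 'I_n.+1 -> 'I_(n + m).+1)
    (v : 'I_m.+1 -> 'I_(n + m).+1) :
  (forall k, (exists2 i, i != l & u i = k) \/ (exists j, v j = k)) ->
  bijective_labelling l u v.
Proof.
move=> uv; rewrite /bijective_labelling perm_sym; set L := _ ++ _.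
have sub : {subset enum 'I_(n + m).+1 <= L}.
  move=> k _; rewrite mem_cat; have [[i il <-]|[j <-]] := uv k.
    by rewrite orbC map_f // mem_rem_uniq ?enum_uniq // inE il mem_enum.
  by rewrite map_f // mem_enum.
have sizeL : (size L <= size (enum 'I_(n + m).+1))%N.
  by rewrite size_cat 2!size_map (size_rem (mem_enum _ l)) !size_enum_ord; lia.
apply: uniq_perm; first exact: enum_uniq.
  exact: leq_size_uniq (enum_uniq _) sub sizeL.
by have [] := uniq_min_size (enum_uniq _) sub sizeL.
Qed.

Lemma shuffle_labelling n m (l : 'I_n.+1) u v :
  is_shuffle (m := m) l u v -> bijective_labelling l u v.
Proof.
move=> [_ _ uv cov]; apply: bijective_labellingP => k.
have /orP[/codomP[i ->]|/codomP[j ->]] := cov k; last by right; exists j.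
have [->|il] := eqVneq i l; last by left; exists i.
by right; exists ord0; rewrite uv.
Qed.

Lemma outer_labelE n m (l i : 'I_n.+1) :
  outer_label m l i = (if i < l then i : nat else i + m)%N :> nat.
Proof.
rewrite inordK //; case: ifP => _; have := ltn_ord i; lia.
Qed.

Lemma inner_labelE n m (l : 'I_n.+1) (j : 'I_m.+1) :
  inner_label l j = (l + j)%N :> nat.
Proof. rewrite inordK //; have := ltn_ord l; have := ltn_ord j; lia. Qed.

(** The labels split into three intervals: those below [l], the block of the inserted tree, and
    those above, shifted by [m]. *)
Lemma composition_labelling n m (l : 'I_n.+1) :
  bijective_labelling l (outer_label m l) (@inner_label n m l).
Proof.
apply: bijective_labellingP => k; have kN := ltn_ord k; have lN := ltn_ord l.
have [kl|lk] := ltnP k l.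
  have kn : (k < n.+1)%N by lia.
  left; exists (Ordinal kn); first by rewrite -val_eqE /=; lia.
  by apply/val_inj; rewrite /= outer_labelE /= kl.
have [klm|lmk] := ltnP k (l + m).+1.
  have km : (k - l < m.+1)%N by lia.
  right; exists (Ordinal km); apply/val_inj; rewrite /= inner_labelE /=; lia.
have km : (k - m < n.+1)%N by lia.
left; exists (Ordinal km); first by rewrite -val_eqE /=; lia.
by apply/val_inj; rewrite /= outer_labelE /=; case: ifP => /=; lia.
Qed.

End Labellings.

Section CompTree.
Variables (I : eqType) (S : signature I).

Lemma perm_leaves_graft (X Y : eqType) (f : X -> tree S Y) t s :
  perm_eq (leaves t) s ->
  perm_eq (leaves (graft f t)) (flatten [seq leaves (f x) | x <- s]).
Proof. by move=> ts; rewrite leaves_graft perm_flatten // perm_map. Qed.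

(** An equality because both directions serve: composites are monomials, and conversely a composite
    known to be a monomial certifies its labelling (in [eqv_subst]). *)
Lemma perm_leaves_comp_tree n m N (l : 'I_n) (u : 'I_n -> 'I_N)
    (v : 'I_m -> 'I_N) (s : tree S 'I_n) t :
  perm_eq (leaves s) (enum 'I_n) -> perm_eq (leaves t) (enum 'I_m) ->
  perm_eq (leaves (comp_tree l u v s t)) (enum 'I_N) = bijective_labelling l u v.
Proof.
move=> sn tm; apply: permPl.
have /(perm_trans sn) sl := perm_to_rem (mem_enum 'I_n l).
apply: perm_trans (perm_leaves_graft _ sl) _; rewrite /= eqxx leaves_relabel.
apply: perm_cat; first exact: perm_map.
rewrite (_ : flatten _ = map u (rem l (enum 'I_n))) //.
have : all (predC1 l) (rem l (enum 'I_n)).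
  by apply/allP => i; rewrite mem_rem_uniq ?enum_uniq // inE => /andP[].
by elim: (rem l _) => //= i r IH /andP[/negPf -> /IH ->].
Qed.

Lemma well_coloured_comp_tree n m N (l : 'I_n) (u : 'I_n -> 'I_N)
    (v : 'I_m -> 'I_N) chi psi omega c (s : tree S 'I_n) t :
  comp_colouring l u v chi psi omega ->
  well_coloured chi s c -> well_coloured psi t (chi l) ->
  well_coloured omega (comp_tree l u v s t) c.
Proof.
move=> [ou ov] sc tl; apply: well_coloured_graft sc => i _.
case: eqP => [->|/eqP il]; last by rewrite /= ou.
rewrite well_coloured_relabel -(@eq_in_well_coloured _ _ _ psi) // => j _.
by rewrite /= ov.
Qed.

Lemma sym_monomial_comp_tree n m N (l : 'I_n) (u : 'I_n -> 'I_N)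
    (v : 'I_m -> 'I_N) chi psi omega c (s : tree S 'I_n) t :
  bijective_labelling l u v -> comp_colouring l u v chi psi omega ->
  sym_monomial chi c s -> sym_monomial psi (chi l) t ->
  sym_monomial omega c (comp_tree l u v s t).
Proof.
move=> luv col /andP[sc sn] /andP[tl tm]; apply/andP; split.
  exact: well_coloured_comp_tree col sc tl.
by rewrite perm_leaves_comp_tree.
Qed.

Hypothesis inputs_neq0 : forall g : S, inputs g != [::].

Lemma min_leaf_graft n N (F : 'I_n -> tree S 'I_N) (u : 'I_n -> 'I_N) s :
  {homo u : i j / (i < j)%N} ->
  {in leaves s, forall i, (0 < size (leaves (F i)))%N /\ min_leaf (F i) = u i} ->
  (0 < size (leaves s))%N ->
  exists i : 'I_n, min_leaf s = i /\ min_leaf (graft F s) = u i.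
Proof.
move=> umono Fu s0; have [i si si_min] := min_leaf_mem s0; exists i; split=> //.
have [Fi0 Fiu] := Fu _ si.
apply: min_leafE => [|k]; rewrite leaves_graft.
  have [k ki] := min_leaf_mem Fi0; rewrite Fiu => /val_inj ->.
  by apply/flattenP; exists (leaves (F i)) => //; apply/mapP; exists i.
case/flattenP => _ /mapP[j sj ->] kj; have [_ Fju] := Fu _ sj.
apply: leq_trans (min_leaf_le kj); rewrite Fju.
have := min_leaf_le sj; rewrite si_min leq_eqVlt => /orP[/eqP/val_inj ->//|].
by move/umono; apply: ltnW.
Qed.

(** The smallest leaf above a vertex of [s] becomes its image under [u], and a strictly increasing
    [u] keeps the order of these minima. *)
Lemma increasing_graft n N (F : 'I_n -> tree S 'I_N) (u : 'I_n -> 'I_N)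
    (chi : 'I_n -> I) c s :
  {homo u : i j / (i < j)%N} ->
  {in leaves s, forall i, [/\ (0 < size (leaves (F i)))%N,
    min_leaf (F i) = u i & increasing (F i)]} ->
  well_coloured chi s c -> increasing s -> increasing (graft F s).
Proof.
move=> umono; elim: s c => [x|g ts IH] c Fu.
  by move=> _ _; have [] // := Fu x; rewrite inE.
move=> /= /andP[_ wts] /andP[srt inc].
have ts0 : all (fun t => 0 < size (leaves t))%N ts.
  elim: ts (inputs g) wts {IH Fu srt inc} => [|t ts IHts] [|d ds] //=.
  by move=> /andP[/(size_leaves_gt0 inputs_neq0) -> /IHts ->].
apply/andP; split.
  rewrite -map_comp; move: srt; rewrite !sorted_map.
  (* The minimum of a leafless tree is the default [n], so the transfer is restricted to subtrees
     that have a leaf. *)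
  pose P (t : tree S 'I_n) := (0 < size (leaves t))%N && all [in leaves (Node g ts)] (leaves t).
  apply: (@sub_in_sorted _ P) => [s t /andP[s0 sl] /andP[t0 tl] /= st|].
    have get (r : tree S 'I_n) : all [in leaves (Node g ts)] (leaves r) ->
      {in leaves r, forall i,
        (0 < size (leaves (F i)))%N /\ min_leaf (F i) = u i}.
      by move=> /allP rl i /rl il; have [] := Fu i il.
    have [i [si ->]] := min_leaf_graft umono (get _ sl) s0.
    have [j [tj ->]] := min_leaf_graft umono (get _ tl) t0.
    by apply: umono; rewrite -si -tj.
  apply/allP => t tts; apply/andP; split; first exact: (allP ts0).
  apply/allP => i it; apply/flattenP; exists (leaves t) => //; exact: map_f.
rewrite all_map; elim: ts (inputs g) IH Fu wts inc {srt ts0} => //= t ts IHts.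
move=> [|d ds] //= [IHt /IHts IH] Fu /andP[wt wts] /andP[it its].
apply/andP; split; first by apply: IHt wt it => i ii; apply: Fu; rewrite mem_cat ii.
by apply: (IH ds) => // i ii; apply: Fu; rewrite mem_cat ii orbT.
Qed.

(** The condition [u l = v ord0] says that the smallest leaf of the grafted tree is the label that
    [u] gives to [l]; so [increasing_graft] treats [l] like any other leaf. *)
Lemma shuffle_monomial_comp_tree n m (l : 'I_n.+1) u
    (v : 'I_m.+1 -> 'I_(n + m).+1) chi psi omega c (s : tree S 'I_n.+1) t :
  is_shuffle l u v -> comp_colouring l u v chi psi omega ->
  shuffle_monomial chi c s -> shuffle_monomial psi (chi l) t ->
  shuffle_monomial omega c (comp_tree l u v s t).
Proof.
move=> luv col /andP[ms is_] /andP[mt it]; apply/andP; split.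
  exact: sym_monomial_comp_tree (shuffle_labelling luv) col ms mt.
case: luv (ms) (mt) => umono vmono ulv0 _ /andP[ws _] /andP[wt tm].
have vt : {in leaves t, forall j, [/\ (0 < size (leaves (Leaf (v j) : tree S _)))%N,
    min_leaf (Leaf (v j) : tree S _) = v j & increasing (Leaf (v j) : tree S _)]}.
  by move=> j _; split=> //; apply/minn_idPl/ltnW/ltn_ord.
apply: increasing_graft umono _ ws is_ => i _; case: (i =P l) => [->|_]; last first.
  by split=> //; apply/minn_idPl/ltnW/ltn_ord.
split.
- by rewrite leaves_relabel size_map (size_leaves_gt0 inputs_neq0 wt).
- rewrite ulv0; apply: min_leafE => [|k]; rewrite leaves_relabel.
    by rewrite map_f // (perm_mem tm) mem_enum.
  case/mapP => j _ ->; have [->//|j0] := eqVneq j ord0.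
  by apply/ltnW/vmono; rewrite lt0n.
- exact: increasing_graft vmono vt wt it.
Qed.

Variable K : fieldType.

Lemma coeff_sum_comp_elt n m N (l : 'I_n) (u : 'I_n -> 'I_N) (v : 'I_m -> 'I_N)
    (f : elt K S n) g :
  coeff_sum (comp_elt l u v f g) = coeff_sum g * coeff_sum f.
Proof.
apply: coeff_sum_fglift => s _; rewrite (@coeff_sum_fglift _ _ _ _ _ 1) ?mul1r //.
by move=> t _; rewrite coeff_sumU.
Qed.

Lemma all_dom_comp_elt n m N (l : 'I_n) (u : 'I_n -> 'I_N) (v : 'I_m -> 'I_N)
    (P : pred (tree S 'I_n)) (Q : pred (tree S 'I_m)) (R : pred (tree S 'I_N))
    (f : elt K S n) g :
  (forall s t, P s -> Q t -> R (comp_tree l u v s t)) ->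
  all P (dom f) -> all Q (dom g) -> all R (dom (comp_elt l u v f g)).
Proof.
move=> PQR /allP Pf /allP Qg; apply: all_dom_fglift => s sf.
apply: all_dom_fglift => t tg; rewrite all_domU.
by apply: PQR; [apply: Pf|apply: Qg].
Qed.

(* The coefficient sum is multiplicative for compositions, hence the elements
   on which it vanishes form an ideal. *)
Definition zero_sum (F : Defs.family K S) : Defs.family K S :=
  fun n chi c f => F n chi c f /\ coeff_sum f = 0.

Lemma subspaces_zero_sum (F : Defs.family K S) :
  subspaces F F -> subspaces F (zero_sum F).
Proof.
move=> FF n chi c; have [_ F0 FD] := FF n chi c; split=> [f [] //||].
  by split=> //; rewrite raddf0.
move=> a f g [Ff f0] [Fg g0]; split; first exact: FD.
by rewrite linearP /= f0 g0 scaler0 addr0.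
Qed.

Lemma zero_sum_comp (F : Defs.family K S) L :
  comp_closed F F L -> comp_closed F (zero_sum F) L.
Proof.
move=> FF n m l u v chi psi omega c f g Luv col fg; split.
  by apply: (FF _ _ _ _ _ _ _ _ _ _ _ Luv col); left; case: fg => [[[]]|[? []]].
rewrite coeff_sum_comp_elt.
by case: fg => [[[_ ->] _]|[_ [_ ->]]]; rewrite ?mul0r ?mulr0.
Qed.

Lemma subspaces_all (P : forall n, {ffun 'I_n -> I} -> I -> pred (tree S 'I_n)) :
  let F : Defs.family K S := fun n chi c f => all (P n chi c) (dom f) in
  subspaces F F.
Proof.
move=> F n chi c; split=> // [|a f g Ff Fg]; first exact: all_dom0.
by apply: all_domD => //; apply: all_domZ.
Qed.

Lemma zero_sum_shuffle_ideal :
  is_shuffle_ideal (zero_sum (@free_shuffle K _ S)).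
Proof.
split; first exact/subspaces_zero_sum/subspaces_all.
apply: zero_sum_comp => n m l u v chi psi omega c f g luv col [] [ff gg];
  apply: all_dom_comp_elt ff gg => s t; exact: shuffle_monomial_comp_tree.
Qed.

End CompTree.

Section SymAct.
Variables (I : eqType) (S : signature I).

Lemma map_perm_enum (T : finType) (h : T -> T) :
  injective h -> perm_eq (map h (enum T)) (enum T).
Proof.
move=> inj_h; apply: uniq_perm => [||x]; first by rewrite (map_inj_uniq inj_h) enum_uniq.
  exact: enum_uniq.
rewrite mem_enum inE; have [g hg gh] := injF_bij inj_h.
by apply/mapP; exists (g x); rewrite ?mem_enum ?gh.
Qed.

Lemma sym_monomial_act n (sigma : 'S_n) chi c (t : tree S 'I_n) :
  sym_monomial chi c t ->
  sym_monomial (perm_colouring sigma chi) c (relabel (sigma^-1)%g t).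
Proof.
move=> /andP[wt tn]; apply/andP; split.
  rewrite well_coloured_relabel -(@eq_in_well_coloured _ _ _ chi) // => i _.
  by rewrite /= ffunE permKV.
rewrite leaves_relabel; apply: perm_trans (perm_map _ tn) _.
exact/map_perm_enum/perm_inj.
Qed.

Lemma zero_sum_sym_ideal (K : fieldType) :
  is_sym_ideal (zero_sum (@free_sym K _ S)).
Proof.
split; first exact/subspaces_zero_sum/subspaces_all.
  move=> n sigma chi c f [/allP ff f0]; split.
    by apply: all_dom_fglift => t /ff /sym_monomial_act; rewrite all_domU; apply.
  rewrite (@coeff_sum_fglift _ _ _ _ _ 1) ?f0 ?mulr0 // => t _.
  exact: coeff_sumU.
apply: zero_sum_comp => n m l u v chi psi omega c f g [-> ->] col [] [ff gg];
  apply: all_dom_comp_elt ff gg => s t;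
  exact/sym_monomial_comp_tree/col/composition_labelling.
Qed.

End SymAct.

(** * The path-lexicographic order *)

Section StrictOrders.

Definition trichotomous (T : eqType) (lt : rel T) :=
  forall x y, [|| lt x y, x == y | lt y x].

Lemma lex_lt_trans (T : eqType) (lt : rel T) :
  transitive lt -> transitive (lex_lt lt).
Proof.
move=> lt_trans s2 s1; elim: s1 s2 => [|x s1 IH] [|y s2] [|z s3] //=.
case/orP => [xy|/andP[/eqP -> s12]]; case/orP => [yz|/andP[/eqP <- s23]].
- by rewrite (lt_trans _ _ _ xy yz).
- by rewrite xy.
- by rewrite yz.
- by rewrite eqxx (IH _ _ s12 s23) orbT.
Qed.

Lemma lex_lt_trichotomous (T : eqType) (lt : rel T) :
  trichotomous lt -> trichotomous (lex_lt lt).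
Proof.
move=> tri; elim=> [|x s1 IH] [|y s2] //=; rewrite eqseq_cons.
case/or3P: (tri x y) => [->//|/eqP ->|->]; last by rewrite !orbT.
by rewrite eqxx /=; case/or3P: (IH s2) => ->; rewrite !orbT.
Qed.

Section Deglex.
Variables (I : eqType) (S : signature I) (lt : rel S).

Lemma deglex_lt_trans : transitive lt -> transitive (deglex_lt lt).
Proof.
move=> lt_trans w2 w1 w3; rewrite /deglex_lt.
case/orP => [s12|/andP[/eqP -> l12]]; case/orP => [s23|/andP[/eqP <- l23]].
- by rewrite (ltn_trans s12 s23).
- by rewrite s12.
- by rewrite s23.
- by rewrite eqxx (lex_lt_trans lt_trans l12 l23) orbT.
Qed.

Lemma deglex_lt_trichotomous : trichotomous lt -> trichotomous (deglex_lt lt).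
Proof.
move=> tri w1 w2; rewrite /deglex_lt; case: (ltngtP (size w1) (size w2)) => //= _.
  by rewrite orbT.
exact: lex_lt_trichotomous.
Qed.

Lemma deglex_lt_cons g w1 w2 :
  ~~ lt g g -> deglex_lt lt (g :: w1) (g :: w2) = deglex_lt lt w1 w2.
Proof. by rewrite /deglex_lt /= ltnS eqSS eqxx => /negPf ->. Qed.

(** Lengths all grow by one and the new first letters tie: comparison is unaffected by a common
    root. *)
Lemma lex_deglex_lt_cons g vs ws :
  ~~ lt g g ->
  lex_lt (deglex_lt lt) (map (cons g) vs) (map (cons g) ws) =
  lex_lt (deglex_lt lt) vs ws.
Proof.
move=> gg; elim: vs ws => [|v vs IH] [|w ws] //=.
by rewrite deglex_lt_cons // IH eqseq_cons eqxx.
Qed.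

Lemma path_lex_lt_trans n : transitive lt -> transitive (@path_lex_lt _ S lt n).
Proof.
move=> lt_trans t s u; rewrite /path_lex_lt.
have dtr := lex_lt_trans (deglex_lt_trans lt_trans).
case/orP => [st|/andP[/eqP -> st]]; case/orP => [tu|/andP[/eqP <- tu]].
- by rewrite (dtr _ _ _ st tu).
- by rewrite st.
- by rewrite tu.
(* The tie-break on leaves is reversed, so the two comparisons compose in the opposite order. *)
- rewrite eqxx (lex_lt_trans _ tu st) ?orbT // => i j k; exact: ltn_trans.
Qed.

End Deglex.

(** Totality is asked only on [s], because [path_lex_lt_trichotomous] provides it only for monomials
    of one component. *)
Lemma max_seq (T : eqType) (lt : rel T) (s : seq T) :
  transitive lt ->
  {in s &, forall x y, [|| lt x y, x == y | lt y x]} -> s != [::] ->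
  exists2 x, x \in s & forall y, y \in s -> y != x -> lt y x.
Proof.
move=> lt_trans; elim: s => [//|x s IH] tri _.
have [->|s0] := eqVneq s [::].
  by exists x; rewrite ?inE // => y; rewrite inE => /eqP ->; rewrite eqxx.
have [|//|m ms mmax] := IH.
  by move=> y z ys zs; apply: tri; rewrite inE ?ys ?zs orbT.
have m_in : m \in x :: s by rewrite inE ms orbT.
case/or3P: (tri x m (mem_head _ _) m_in) => [xm|/eqP xm|mx].
- exists m => // y; rewrite inE => /orP[/eqP ->//|]; exact: mmax.
- exists m => // y; rewrite inE => /orP[/eqP -> |]; last exact: mmax.
  by rewrite xm eqxx.
- exists x; rewrite ?mem_head // => y; rewrite inE => /orP[/eqP ->|ys yx].
    by rewrite eqxx.
  by have [->//|ym] := eqVneq y m; apply: lt_trans mx; apply: mmax.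
Qed.

End StrictOrders.

(** * Recovering a tree from its leaves and the paths to them *)

Section TreeFromPaths.
Variables (I : eqType) (S : signature I).

Fixpoint leaf_paths X (p : seq S) (t : tree S X) : seq (X * seq S) :=
  match t with
  | Leaf x => [:: (x, p)]
  | Node g ts => flatten (map (leaf_paths (rcons p g)) ts)
  end.

(** [path_word] finds a leaf by its label, so it agrees with the traversal when labels are
    distinct. *)
Lemma leaf_pathsE (X : eqType) p (t : tree S X) :
  uniq (leaves t) ->
  leaf_paths p t = [seq (x, p ++ path_word x t) | x <- leaves t].
Proof.
elim: t p => [x|g ts IH] p /=; first by rewrite cats0.
under [in RHS]eq_map do rewrite -cat_rcons; move: (rcons p g) => q.
elim: ts IH => //= t ts IHts [IHt /IHts IH] U.
have /and3P[Ut disj Uts] : [&& uniq (leaves t),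
  ~~ has [in leaves t] (flatten (map (@leaves S X) ts)) &
  uniq (flatten (map (@leaves S X) ts))] by rewrite -cat_uniq.
rewrite map_cat IHt // IH //; congr (_ ++ _); apply/eq_in_map => x xt.
  rewrite xt (_ : flatten _ = [::]) ?cats0 //.
  have {disj} : x \notin flatten (map (@leaves S X) ts).
    by apply: contraNN disj => xts; apply/hasP; exists x.
  elim: ts {IHts IH U Uts} => //= s ts IHts; rewrite mem_cat negb_or.
  by move=> /andP[/negPf -> /IHts ->].
by case: ifP => // xt'; case/hasP: disj; exists x.
Qed.

Hypothesis inputs_neq0 : forall g : S, inputs g != [::].

Let root_word X (t : tree S X) := if t is Node g _ then [:: g] else [::].

(** The first leaf exists since every operation has an input, and right after [p] its path shows the
    root: this tells leaves from vertices and one root label from another. *)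
Lemma head_leaf_paths X (chi : X -> I) c p (t : tree S X) :
  well_coloured chi t c ->
  exists x q r, leaf_paths p t = (x, p ++ root_word t ++ q) :: r.
Proof.
elim: t c p => [x|g ts IH] c p /=; first by exists x, [::], [::]; rewrite cats0.
case/andP=> _; move: (inputs_neq0 g).
case: (inputs g) ts IH => [|d ds] [|t ts] //= [IH _] _ /andP[wt _].
have [x [q [r ->]]] := IH _ (rcons p g) wt.
by rewrite -cats1 -catA; eexists x, _, _.
Qed.

(* The trailing lists [u] and [v] make the induction go through: the paths form
   a prefix code, so the first tree can be read off from the whole list. *)
Lemma leaf_paths_inj X (chi : X -> I) c d p (s t : tree S X) u v :
  well_coloured chi s c -> well_coloured chi t d ->
  leaf_paths p s ++ u = leaf_paths p t ++ v -> s = t /\ u = v.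
Proof.
elim: s c d p t u v => [x|g ss IH] c d p [y|h ts] u v ws wt.
- by case=> -> ->.
- have [y [q [r ->]]] := head_leaf_paths p wt => - [_ /(congr1 size)].
  by rewrite !size_cat /=; lia.
- have [x [q [r ->]]] := head_leaf_paths p ws => - [_ /(congr1 size)].
  by rewrite !size_cat /=; lia.
have [x [q [r E]]] := head_leaf_paths p ws.
have [y [q' [r' E']]] := head_leaf_paths p wt.
move=> Eall; move: (Eall); rewrite E E' => - [_ /(congr1 (drop (size p))) + _].
rewrite !drop_size_cat // => - [eq_gh _]; move: eq_gh ws wt Eall {E E'} => <-.
rewrite /= => /andP[_ wss] /andP[_ wts] E.
suff [-> ->] : ss = ts /\ u = v by [].
elim: ss (inputs g) ts wss wts IH E => [|s ss IHss] [|e es] [|t ts] //=.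
move=> /andP[ws wss] /andP[wt wts] [IHs IH].
rewrite -!catA => /(IHs _ _ _ _ _ _ ws wt) [-> E].
by have [-> ->] := IHss _ _ wss wts IH E.
Qed.

(** If path vectors and leaf words both tie, the lists of leaf paths coincide, and they determine
    the tree. *)
Lemma path_lex_lt_trichotomous (lt : rel S) n (chi : {ffun 'I_n -> I}) c s t :
  trichotomous lt -> sym_monomial chi c s -> sym_monomial chi c t ->
  [|| path_lex_lt lt s t, s == t | path_lex_lt lt t s].
Proof.
move=> tri /andP[ws sn] /andP[wt tn]; rewrite /path_lex_lt.
case/or3P: (lex_lt_trichotomous (deglex_lt_trichotomous tri)
  (path_vector s) (path_vector t)) => [->//|/eqP pst|->]; last by rewrite !orbT.
rewrite pst eqxx /=.
have tri_leaf : trichotomous (fun i j : 'I_n => (i < j)%N).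
  by move=> i j; rewrite -val_eqE; case: (ltngtP (val i) (val j)).
case/or3P: (lex_lt_trichotomous tri_leaf (leaves s) (leaves t)) => [->|/eqP lst|->];
  rewrite ?orbT //.
suff [-> _] : s = t /\ ([::] : seq ('I_n * seq S)) = [::] by rewrite eqxx orbT.
apply: (leaf_paths_inj (p := [::]) ws wt); rewrite !cats0.
have uniq_perm_enum (r : tree S 'I_n) : perm_eq (leaves r) (enum 'I_n) -> uniq (leaves r).
  by move/perm_uniq ->; apply: enum_uniq.
rewrite !leaf_pathsE ?uniq_perm_enum // lst; apply/eq_in_map => j _; congr (_, _).
by move/eq_in_map: pst => /(_ j (mem_enum _ j)).
Qed.

End TreeFromPaths.

(** * The relations and their leading monomials *)

Lemma icom_inputs_neq0 (g : icom_sig) : inputs g != [::].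
Proof. by case: g. Qed.

Lemma shuffle_inputs_neq0 (g : shuffle_sig) : inputs g != [::].
Proof. by case: g. Qed.

Lemma enum_ord2 : enum 'I_2 = [:: @Ordinal 2 0 isT; @Ordinal 2 1 isT].
Proof. by apply: (inj_map val_inj); rewrite val_enum_ord. Qed.

Lemma enum_ord3 :
  enum 'I_3 = [:: @Ordinal 3 0 isT; @Ordinal 3 1 isT; @Ordinal 3 2 isT].
Proof. by apply: (inj_map val_inj); rewrite val_enum_ord. Qed.

(** * From symmetric monomials to shuffle monomials *)

Section ToShuffle.
Variable n : nat.
Implicit Types (t : tree icom_sig 'I_n) (chi : {ffun 'I_n -> colour}).

(** Distinct labels give the two arguments of a binary vertex distinct minima, so the order chosen
    by [to_shuffle] is strictly increasing. The leaves are only permuted, as arguments may be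
    exchanged. *)
Lemma to_shuffle_spec chi c t : well_coloured chi t c -> uniq (leaves t) ->
  [/\ well_coloured chi (to_shuffle t) c, increasing (to_shuffle t) &
      perm_eq (leaves (to_shuffle t)) (leaves t)].
Proof.
elim: t c => [x|g ts IH] c //= /andP[gc].
have min_neq (a b : tree shuffle_sig 'I_n) (s u : tree icom_sig 'I_n) d e :
    well_coloured chi a d -> well_coloured chi b e ->
    perm_eq (leaves a) (leaves s) -> perm_eq (leaves b) (leaves u) ->
    uniq (leaves s ++ leaves u) -> min_leaf a != min_leaf b.
  move=> wa wb sa ub; rewrite cat_uniq => /and3P[_ disj _].
  have [i ia ->] := min_leaf_mem (size_leaves_gt0 shuffle_inputs_neq0 wa).
  have [j jb ->] := min_leaf_mem (size_leaves_gt0 shuffle_inputs_neq0 wb).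
  apply: contraNneq disj => /val_inj ij; apply/hasP.
  by exists i; rewrite -?(perm_mem sa) // ij -(perm_mem ub).
have cat_spec (s u : tree icom_sig 'I_n) (d e : colour) :
    (uniq (leaves s) -> [/\ well_coloured chi (to_shuffle s) d,
       increasing (to_shuffle s) & perm_eq (leaves (to_shuffle s)) (leaves s)]) ->
    (uniq (leaves u) -> [/\ well_coloured chi (to_shuffle u) e,
       increasing (to_shuffle u) & perm_eq (leaves (to_shuffle u)) (leaves u)]) ->
    uniq (leaves s ++ leaves u) ->
    [/\ well_coloured chi (to_shuffle s) d, increasing (to_shuffle s),
        perm_eq (leaves (to_shuffle s)) (leaves s) &
        [/\ well_coloured chi (to_shuffle u) e, increasing (to_shuffle u),
            perm_eq (leaves (to_shuffle u)) (leaves u) &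
            min_leaf (to_shuffle s) != min_leaf (to_shuffle u)]].
  move=> Hs Hu U; move: (U); rewrite cat_uniq => /and3P[/Hs[? ? ps] _ /Hu[? ? pu]].
  by split=> //; split=> //; apply: min_neq U; eassumption.
case: g gc => /= gc; case: ts IH => [|s [|u [|? ?]]] //=; rewrite ?andbF ?andbT ?cats0 //.
- move=> [IHs [IHu _]] /andP[/IHs {}IHs /IHu {}IHu] U.
  have [ws is_ ps [wu iu pu]] := cat_spec _ _ _ _ IHs IHu U; rewrite /= gc.
  case: ltngtP => //= lt_su _; rewrite ws wu is_ iu lt_su ?cats0; split=> //.
    exact: perm_cat.
  by rewrite perm_catC; apply: perm_cat.
- move=> [IHs _] ws U; have [] := IHs _ ws U; rewrite gc /= => -> -> ps.
  by rewrite ?cats0.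
- move=> [IHs [IHu _]] /andP[/IHs {}IHs /IHu {}IHu] U.
  have [ws is_ ps [wu iu pu]] := cat_spec _ _ _ _ IHs IHu U.
  case: ltngtP => //= lt_su _; rewrite gc ws wu is_ iu lt_su ?cats0; split=> //.
    exact: perm_cat.
  by rewrite perm_catC; apply: perm_cat.
Qed.

Lemma shuffle_monomial_to_shuffle chi c t :
  sym_monomial chi c t -> shuffle_monomial chi c (to_shuffle t).
Proof.
move=> /andP[wt tn]; have U : uniq (leaves t) by rewrite (perm_uniq tn) enum_uniq.
have [ws inc lt] := to_shuffle_spec wt U; rewrite /shuffle_monomial /sym_monomial.
by rewrite ws inc (perm_trans lt tn).
Qed.

Lemma nvertices_to_shuffle chi c t :
  well_coloured chi t c -> nvertices (to_shuffle t) = nvertices t.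
Proof.
elim: t c => [//|g ts IH] c /= /andP[_]; case: g; case: ts IH => [|s [|u [|? ?]]] //=;
  rewrite ?andbF ?andbT //.
- by move=> [IHs [IHu _]] /andP[/IHs es /IHu eu]; case: ifP => _ /=; rewrite es eu //; lia.
- by move=> [IHs _] /IHs ->.
- by move=> [IHs [IHu _]] /andP[/IHs es /IHu eu]; case: ifP => _ /=; rewrite es eu //; lia.
Qed.

Lemma nvertices_relabel (S : eqType) X Y (f : X -> Y) (t : tree S X) :
  nvertices (relabel f t) = nvertices t.
Proof.
elim: t => //= g ts IH; congr (_.+1).
by elim: ts IH => //= t ts IHts [-> /IHts ->].
Qed.

End ToShuffle.

Section Relations.
Variable K : fieldType.

Lemma icom_relationP n (chi : {ffun 'I_n -> colour}) c (f : elt K icom_sig n) :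
  icom_relation chi c f -> exists s t, [/\ f = << s >> - << t >>,
    sym_monomial chi c s, sym_monomial chi c t & nvertices s = 2 /\ nvertices t = 2].
Proof.
case=> {n chi c f}; do 2 eexists; split; try reflexivity;
  rewrite /sym_monomial ?enum_ord2 ?enum_ord3 /= ?ffunE //.
Qed.

Lemma zero_sum_icom n (chi : {ffun 'I_n -> colour}) c (f : elt K icom_sig n) :
  alpha_symmetry chi c f \/ icom_relation chi c f ->
  zero_sum (@free_sym K _ icom_sig) chi c f.
Proof.
have pair_zero_sum m psi d (s t : tree icom_sig 'I_m) :
    sym_monomial psi d s -> sym_monomial psi d t ->
    zero_sum (@free_sym K _ icom_sig) psi d (<< s >> - << t >>).
  move=> ms mt; split; last exact: coeff_sumBU.
  by apply: all_domD; [|apply: all_domN]; rewrite all_domU.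
case=> [[]|/icom_relationP[s [t [-> ms mt _]]]]; apply: pair_zero_sum => //;
  by rewrite /sym_monomial ?enum_ord2 /= ?ffunE.
Qed.

Lemma to_shuffle_act_pair n (sigma : 'S_n) (s t : tree icom_sig 'I_n) :
  to_shuffle_elt (sym_act sigma (<< s >> - << t >> : elt K icom_sig n)) =
  << to_shuffle (relabel (sigma^-1)%g s) >> -
  << to_shuffle (relabel (sigma^-1)%g t) >>.
Proof.
by rewrite /to_shuffle_elt /sym_act /relabel_elt !(fgliftB, fgliftU).
Qed.

Lemma shuffle_icom_relationP n (chi : {ffun 'I_n -> colour}) c
    (f : elt K shuffle_sig n) :
  shuffle_icom_relation chi c f -> exists s t, [/\ f = << s >> - << t >>,
    shuffle_monomial chi c s, shuffle_monomial chi c t &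
    nvertices s = 2 /\ nvertices t = 2].
Proof.
case=> [chi0 [f0 [sigma [/icom_relationP[s [t [-> ms mt [ns nt]]]] -> ->]]]].
have /andP[ws _] := sym_monomial_act sigma ms.
have /andP[wt _] := sym_monomial_act sigma mt.
exists (to_shuffle (relabel (sigma^-1)%g s)), (to_shuffle (relabel (sigma^-1)%g t)).
split; first exact: to_shuffle_act_pair.
- exact/shuffle_monomial_to_shuffle/sym_monomial_act.
- exact/shuffle_monomial_to_shuffle/sym_monomial_act.
- by rewrite (nvertices_to_shuffle ws) (nvertices_to_shuffle wt) !nvertices_relabel.
Qed.

Lemma shuffle_icom_relation_quadratic : is_quadratic (@shuffle_icom_relation K).
Proof.
move=> n chi c f /shuffle_icom_relationP[s [t [-> _ _ [ns nt]]]].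
by apply/allP => u /domBU; rewrite !inE => /orP[]/eqP ->; apply/eqP.
Qed.

Lemma shuffle_icom_ideal_zero_sum n (chi : {ffun 'I_n -> colour}) c
    (f : elt K shuffle_sig n) :
  shuffle_icom_ideal chi c f -> zero_sum (@free_shuffle K _ shuffle_sig) chi c f.
Proof.
move=> If; apply: (If (zero_sum (@free_shuffle K _ shuffle_sig))).
  exact: zero_sum_shuffle_ideal shuffle_inputs_neq0 K.
move=> k psi d g /shuffle_icom_relationP[s [t [-> ms mt _]]].
split; last exact: coeff_sumBU.
by apply: all_domD; [|apply: all_domN]; rewrite all_domU.
Qed.

Lemma icom_ideal_zero_sum n (chi : {ffun 'I_n -> colour}) c (f : elt K icom_sig n) :
  icom_ideal chi c f -> zero_sum (@free_sym K _ icom_sig) chi c f.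
Proof.
move=> If; apply: (If (zero_sum (@free_sym K _ icom_sig))).
  exact: zero_sum_sym_ideal.
exact: zero_sum_icom.
Qed.

Definition leading_monomial k (psi : {ffun 'I_k -> colour}) d s :=
  exists2 g : elt K shuffle_sig k,
    shuffle_icom_relation psi d g & leading shuffle_op_lt g s.

(** Both signs are needed: after relabelling, the larger monomial of a relation may be either of its
    two terms. *)
Lemma leading_pair n (s t : tree shuffle_sig 'I_n) :
  s != t -> path_lex_lt shuffle_op_lt t s ->
  leading shuffle_op_lt (<< s >> - << t >> : elt K _ n) s /\
  leading shuffle_op_lt (<< t >> - << s >> : elt K _ n) s.
Proof.
move=> st lt_ts; split; split.
- exact: domBU1.
- by move=> u /domBU; rewrite !inE => /orP[]/eqP -> //; rewrite eqxx.
- by apply: domBU2; rewrite eq_sym.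
- by move=> u /domBU; rewrite !inE => /orP[]/eqP -> //; rewrite eqxx.
Qed.

Lemma leading_monomial_intro n (chi : {ffun 'I_n -> colour}) c
    (h : 'I_n -> 'I_n) (s t : tree icom_sig 'I_n) u v :
  injective h ->
  icom_relation chi c (<< s >> - << t >> : elt K _ n) \/
  icom_relation chi c (<< t >> - << s >> : elt K _ n) ->
  u = to_shuffle (relabel h s) -> v = to_shuffle (relabel h t) ->
  u != v -> path_lex_lt shuffle_op_lt v u ->
  exists psi, leading_monomial psi c u.
Proof.
move=> inj_h Rst eu ev uv lt_vu; have [Luv Lvu] := leading_pair uv lt_vu.
(* [sym_act sigma] relabels by the inverse of [sigma]. *)
pose sigma := (perm inj_h)^-1%g.
have Erel (r : tree icom_sig 'I_n) : relabel h r = relabel (sigma^-1)%g r.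
  by apply: eq_in_graft => i _; rewrite invgK permE.
exists (perm_colouring sigma chi); case: Rst => R.
  exists (<< u >> - << v >>) => //; exists chi, (<< s >> - << t >>), sigma; split=> //.
  by rewrite to_shuffle_act_pair eu ev !Erel.
exists (<< v >> - << u >>) => //; exists chi, (<< t >> - << s >>), sigma; split=> //.
by rewrite to_shuffle_act_pair eu ev !Erel.
Qed.

End Relations.

(** * The leading monomials of the relations *)

Section LeadingMonomials.
Variable K : fieldType.

Local Notation y1 := (@Ordinal 2 0 isT).
Local Notation y2 := (@Ordinal 2 1 isT).
Local Notation x1 := (@Ordinal 3 0 isT).
Local Notation x2 := (@Ordinal 3 1 isT).
Local Notation x3 := (@Ordinal 3 2 isT).
Local Notation nd g ts := (Node (g : shuffle_sig) ts).

(** The list gives the images of the labels in order; thus [[:: x2; x1; x3]] turns a relation whose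
    first argument has colour [J] into one where label [x2] has colour [J]. *)
Let relabelling n (s : seq 'I_n.+1) (i : 'I_n.+1) := nth ord0 s i.

Lemma relabelling_inj n (s : seq 'I_n.+1) :
  uniq s -> size s = n.+1 -> injective (relabelling s).
Proof.
move=> Us ss i j /eqP; rewrite /relabelling nth_uniq ?ss //.
by move/eqP/val_inj.
Qed.

(** In each component met by the relations, every quadratic shuffle monomial except the smallest
    one, the right comb, is leading: two out of three in each of the four colourings with three
    inputs, one out of two in each of the three colourings with two inputs. These are the eleven
    monomials found here. *)
Lemma leading_alpha_alpha12 : exists psi,
  leading_monomial K psi A (nd ShAlpha [:: nd ShAlpha [:: Leaf x1; Leaf x2]; Leaf x3]).
Proof.
apply: (leading_monomial_intro (@relabelling_inj 2 [:: x1; x2; x3] isT erefl)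
  (or_introl (rel_alpha_comm K)) erefl erefl) => //.
by rewrite /path_lex_lt /path_vector enum_ord3.
Qed.

Lemma leading_alpha_alpha13 : exists psi,
  leading_monomial K psi A (nd ShAlpha [:: nd ShAlpha [:: Leaf x1; Leaf x3]; Leaf x2]).
Proof.
apply: (leading_monomial_intro (@relabelling_inj 2 [:: x1; x2; x3] isT erefl)
  (or_introl (rel_alpha_assoc K)) erefl erefl) => //.
by rewrite /path_lex_lt /path_vector enum_ord3.
Qed.

Lemma leading_r_r12 : exists psi,
  leading_monomial K psi J (nd ShR [:: nd ShR [:: Leaf x1; Leaf x2]; Leaf x3]).
Proof.
apply: (leading_monomial_intro (@relabelling_inj 2 [:: x1; x2; x3] isT erefl)
  (or_introl (rel_r_comm K)) erefl erefl) => //.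
by rewrite /path_lex_lt /path_vector enum_ord3.
Qed.

Lemma leading_r_r13 : exists psi,
  leading_monomial K psi J (nd ShR [:: nd ShR [:: Leaf x1; Leaf x3]; Leaf x2]).
Proof.
apply: (leading_monomial_intro (@relabelling_inj 2 [:: x1; x2; x3] isT erefl)
  (or_introl (rel_r_assoc K)) erefl erefl) => //.
by rewrite /path_lex_lt /path_vector enum_ord3.
Qed.

Lemma leading_r_l12 : exists psi,
  leading_monomial K psi J (nd ShR [:: nd ShL [:: Leaf x1; Leaf x2]; Leaf x3]).
Proof.
apply: (leading_monomial_intro (@relabelling_inj 2 [:: x2; x1; x3] isT erefl)
  (or_introl (rel_r_comm K)) erefl erefl) => //.
by rewrite /path_lex_lt /path_vector enum_ord3.
Qed.

Lemma leading_l_alpha13 : exists psi,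
  leading_monomial K psi J (nd ShL [:: nd ShAlpha [:: Leaf x1; Leaf x3]; Leaf x2]).
Proof.
apply: (leading_monomial_intro (@relabelling_inj 2 [:: x2; x1; x3] isT erefl)
  (or_intror (rel_r_assoc K)) erefl erefl) => //.
by rewrite /path_lex_lt /path_vector enum_ord3.
Qed.

Lemma leading_r_l13 : exists psi,
  leading_monomial K psi J (nd ShR [:: nd ShL [:: Leaf x1; Leaf x3]; Leaf x2]).
Proof.
apply: (leading_monomial_intro (@relabelling_inj 2 [:: x3; x1; x2] isT erefl)
  (or_introl (rel_r_comm K)) erefl erefl) => //.
by rewrite /path_lex_lt /path_vector enum_ord3.
Qed.

Lemma leading_l_alpha12 : exists psi,
  leading_monomial K psi J (nd ShL [:: nd ShAlpha [:: Leaf x1; Leaf x2]; Leaf x3]).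
Proof.
apply: (leading_monomial_intro (@relabelling_inj 2 [:: x3; x1; x2] isT erefl)
  (or_intror (rel_r_assoc K)) erefl erefl) => //.
by rewrite /path_lex_lt /path_vector enum_ord3.
Qed.

Lemma leading_i_r : exists psi,
  leading_monomial K psi A (nd ShI [:: nd ShR [:: Leaf y1; Leaf y2]]).
Proof.
apply: (leading_monomial_intro (@relabelling_inj 1 [:: y1; y2] isT erefl)
  (or_intror (rel_alpha_i K)) erefl erefl) => //.
by rewrite /path_lex_lt /path_vector enum_ord2.
Qed.

Lemma leading_i_l : exists psi,
  leading_monomial K psi A (nd ShI [:: nd ShL [:: Leaf y1; Leaf y2]]).
Proof.
apply: (leading_monomial_intro (@relabelling_inj 1 [:: y2; y1] isT erefl)
  (or_intror (rel_alpha_i K)) erefl erefl) => //.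
by rewrite /path_lex_lt /path_vector enum_ord2.
Qed.

Lemma leading_l_i : exists psi,
  leading_monomial K psi J (nd ShL [:: nd ShI [:: Leaf y1]; Leaf y2]).
Proof.
apply: (leading_monomial_intro (@relabelling_inj 1 [:: y1; y2] isT erefl)
  (or_intror (rel_r_i K)) erefl erefl) => //.
by rewrite /path_lex_lt /path_vector enum_ord2.
Qed.

End LeadingMonomials.

(** * Irreducible shuffle monomials *)

Section Reducible.
Variables (K : fieldType) (n : nat) (chi : {ffun 'I_n -> colour}).

Local Notation x1 := (@Ordinal 3 0 isT).
Local Notation x2 := (@Ordinal 3 1 isT).
Local Notation x3 := (@Ordinal 3 2 isT).
Local Notation nd g ts := (Node (g : shuffle_sig) ts).
Implicit Types t : tree shuffle_sig 'I_n.

Definition reducible t := exists k psi d g s,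
  [/\ @shuffle_icom_relation K k psi d g, leading shuffle_op_lt g s &
      divides psi chi s t].

Lemma reducible_child g ts t :
  reducible t -> t \in ts -> reducible (nd g ts).
Proof.
move=> [k [psi [d [f [s [Rf lead [tau [br wtau mtau]]]]]]]] tts.
exists k, psi, d, f, s; split=> //; exists tau; split=> //=.
rewrite inE; apply/orP; right; apply/flattenP.
by exists (branches t) => //; apply: map_f.
Qed.

Lemma reducible_graft k d (s : tree shuffle_sig 'I_k) (tau : 'I_k -> tree _ 'I_n) :
  (exists psi, leading_monomial K psi d s) ->
  well_coloured chi (graft tau s) d ->
  (forall i j : 'I_k, (i < j)%N -> (min_leaf (tau i) < min_leaf (tau j))%N) ->
  reducible (graft tau s).
Proof.
move=> [psi [g Rg lead_s]] wt mtau.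
have [a [b [gE /andP[ma _] /andP[mb _] _]]] := shuffle_icom_relationP Rg.
have /andP[ws sk] : sym_monomial psi d s.
  by case: lead_s => + _; rewrite gE => /domBU; rewrite !inE => /orP[]/eqP ->.
exists k, psi, d, g, s; split=> //; exists tau; split=> // [|i].
  by case: (graft tau s) => [x|h ts] /=; rewrite inE eqxx.
apply: (well_coloured_graft_inv ws wt).
by rewrite (perm_mem sk) mem_enum.
Qed.

Lemma increasing_left_comb g h (a b e : tree shuffle_sig 'I_n) :
  (0 < size (leaves a))%N -> increasing (nd g [:: nd h [:: a; b]; e]) ->
  (min_leaf a < min_leaf b)%N /\ (min_leaf a < min_leaf e)%N.
Proof.
move=> a0 /= /andP[/andP[lt_e _] /andP[/andP[/andP[lt_ab _] _] _]]; split=> //.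
apply: leq_ltn_trans lt_e; set t := Node h _.
have [|i it ->] := @min_leaf_mem _ _ t.
  by rewrite /= size_cat addn_gt0 a0.
move: it; rewrite /= cats0 mem_cat => /orP[/min_leaf_le //|/min_leaf_le].
by apply/leq_trans/ltnW.
Qed.

(** The smallest leaf lies in [a], so the order of [b] and [e] decides which of the two shuffles of
    the left comb divides the tree; both must therefore be leading. *)
Lemma reducible_left_comb g h d a b e :
  (exists psi, leading_monomial K psi d
     (nd g [:: nd h [:: Leaf x1; Leaf x2]; Leaf x3])) ->
  (exists psi, leading_monomial K psi d
     (nd g [:: nd h [:: Leaf x1; Leaf x3]; Leaf x2])) ->
  well_coloured chi (nd g [:: nd h [:: a; b]; e]) d ->
  (0 < size (leaves a))%N -> min_leaf b != min_leaf e ->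
  increasing (nd g [:: nd h [:: a; b]; e]) ->
  reducible (nd g [:: nd h [:: a; b]; e]).
Proof.
move=> L12 L13 wt a0 be inc; have [ab ae] := increasing_left_comb a0 inc.
case: ltngtP be => // [be|eb] _.
  apply: (reducible_graft (tau := fun i => nth a [:: a; b; e] i) L12 wt).
  by move=> [[|[|[|i]]] //= ?] [[|[|[|j]]] //= ?] //=.
apply: (reducible_graft (tau := fun i => nth a [:: a; e; b] i) L13 wt).
by move=> [[|[|[|i]]] //= ?] [[|[|[|j]]] //= ?] //=.
Qed.

End Reducible.

(** * Right combs and their minimality *)

Section NormalForm.
Variables (K : fieldType) (n : nat) (chi : {ffun 'I_n -> colour}).
Local Notation nd g ts := (Node (g : shuffle_sig) ts).
Implicit Types (t : tree shuffle_sig 'I_n) (x y : 'I_n) (L : seq 'I_n).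

Definition a_leaf x : tree shuffle_sig 'I_n :=
  if chi x is A then Leaf x else nd ShI [:: Leaf x].

(** In colour [J] the spine stays in colour [J], through [l], until the first label of colour [J] is
    met, and then continues in colour [A]. If no label has colour [J], the last leaf is an
    ill-coloured default: no well-coloured tree is then there to be compared with it. *)
Fixpoint comb c x L : tree shuffle_sig 'I_n :=
  match L with
  | [::] => if c is A then a_leaf x else Leaf x
  | y :: L' =>
      match c, chi x with
      | A, _ => nd ShAlpha [:: a_leaf x; comb A y L']
      | J, A => nd ShL [:: Leaf x; comb J y L']
      | J, J => nd ShR [:: Leaf x; comb A y L']
      end
  end.

Lemma leaves_a_leaf x : leaves (a_leaf x) = [:: x].
Proof. by rewrite /a_leaf; case: (chi x). Qed.

Lemma leaves_comb c x L : leaves (comb c x L) = x :: L.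
Proof.
elim: L c x => [|y L IH] [] x /=; rewrite ?leaves_a_leaf //.
  by rewrite IH cats0.
by case: (chi x); rewrite /= IH cats0.
Qed.

(** The path vector restricted to [L]: the induction compares subtrees, which carry only some of the
    labels. *)
Definition paths_lt L (s t : tree shuffle_sig 'I_n) :=
  lex_lt (deglex_lt shuffle_op_lt) [seq path_word j s | j <- L]
    [seq path_word j t | j <- L].

Lemma path_word_left x g t1 t2 :
  x \in leaves t1 -> x \notin leaves t2 ->
  path_word x (nd g [:: t1; t2]) = g :: path_word x t1.
Proof. by move=> /= -> /negPf ->; rewrite /= cats0. Qed.

Lemma path_word_right x g t1 t2 :
  x \notin leaves t1 -> x \in leaves t2 ->
  path_word x (nd g [:: t1; t2]) = g :: path_word x t2.
Proof. by move=> /= /negPf -> ->; rewrite /= cats0. Qed.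

(** The words of [x] tie, and all other words get the same first letter. *)
Lemma paths_lt_right g a s t x L :
  uniq (x :: L) -> leaves a = [:: x] -> perm_eq L (leaves s) ->
  perm_eq L (leaves t) -> paths_lt L s t ->
  paths_lt (x :: L) (nd g [:: a; s]) (nd g [:: a; t]).
Proof.
move=> /andP[xL _] ax Ls Lt lt_st; rewrite /paths_lt !map_cons.
rewrite !path_word_left ?ax ?inE -?(perm_mem Ls) -?(perm_mem Lt) //= eqxx.
apply/orP; right; have right r : perm_eq L (leaves r) ->
    [seq path_word j (nd g [:: a; r]) | j <- L] =
    map (cons (g : shuffle_sig)) [seq path_word j r | j <- L].
  move=> Lr; rewrite -map_comp; apply/eq_in_map => j jL.
  rewrite path_word_right -?(perm_mem Lr) // ax inE.
  by apply: contraNneq xL => <-.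
rewrite !right //; apply: etrans lt_st; apply: lex_deglex_lt_cons.
by rewrite /shuffle_op_lt ltnn.
Qed.

Lemma path_word_gt0 t x :
  well_coloured chi t A -> x \in leaves t -> chi x = J ->
  (0 < size (path_word x t))%N.
Proof. by case: t => [y|g ts] //= /eqP cy; rewrite inE => /eqP ->; rewrite cy. Qed.

Lemma path_word_comb_head c x y L : uniq [:: x, y & L] ->
  path_word x (comb c x (y :: L)) =
  match c, chi x with
  | A, A => [:: ShAlpha : shuffle_sig]
  | A, J => [:: ShAlpha : shuffle_sig; ShI : shuffle_sig]
  | J, A => [:: ShL : shuffle_sig]
  | J, J => [:: ShR : shuffle_sig]
  end.
Proof.
move=> /andP[xL _]; rewrite [comb _ _ _]/=; case: c.
  rewrite path_word_left ?leaves_a_leaf ?leaves_comb ?inE //.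
  by rewrite /a_leaf; case: (chi x); rewrite //= inE eqxx.
by case: (chi x); rewrite path_word_left ?leaves_comb ?inE.
Qed.

Let ordered := sorted (fun i j : 'I_n => (i < j)%N).

Lemma ordered_uniq L : ordered L -> uniq L.
Proof. by apply: sorted_uniq => [i j k|i]; [exact: ltn_trans|exact: ltnn]. Qed.

Lemma ordered_tail x L : ordered (x :: L) -> ordered L.
Proof. exact: path_sorted. Qed.

Lemma ordered_head x L y : ordered (x :: L) -> y \in x :: L -> (x <= y)%N.
Proof.
move=> /order_path_min xL; rewrite inE => /orP[/eqP ->//|yL].
by apply/ltnW/(allP (xL _)) => // i j k; exact: ltn_trans.
Qed.

(* When [t] is not the comb, some leaf before which the path words agree already
   has a larger path word, so ties of path vectors never occur. *)
Definition comb_or_reducible c x L t :=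
  t = comb c x L \/ paths_lt (x :: L) (comb c x L) t /\ reducible K chi t.

Lemma comb_or_reducible_right g a c d x y L t :
  ordered [:: x, y & L] -> leaves a = [:: x] -> perm_eq (y :: L) (leaves t) ->
  comb c x (y :: L) = nd g [:: a; comb d y L] ->
  comb_or_reducible d y L t ->
  comb_or_reducible c x (y :: L) (nd g [:: a; t]).
Proof.
move=> ordL ax Lt Ec [->|[lt_t red]]; first by left.
right; split; last by apply: reducible_child red _; rewrite !inE eqxx orbT.
rewrite Ec; apply: paths_lt_right (ordered_uniq ordL) ax _ Lt lt_t.
by rewrite leaves_comb.
Qed.

Lemma comb_or_reducible_head c x L t :
  deglex_lt shuffle_op_lt (path_word x (comb c x L)) (path_word x t) ->
  reducible K chi t -> comb_or_reducible c x L t.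
Proof. by move=> lt_x red; right; split; rewrite // /paths_lt /= lt_x. Qed.

(** If the smallest label were in [t2], the minimum of [t1] would be even smaller. *)
Lemma ordered_leaves g t1 t2 x L :
  (0 < size (leaves t1))%N ->
  ordered (x :: L) -> perm_eq (x :: L) (leaves (nd g [:: t1; t2])) ->
  increasing (nd g [:: t1; t2]) -> x \in leaves t1 /\ x \notin leaves t2.
Proof.
move=> t10 ordL; rewrite /= cats0 => perm_L /andP[/andP[lt12 _] _].
have U : uniq (leaves t1 ++ leaves t2) by rewrite -(perm_uniq perm_L) ordered_uniq.
have x12 : x \in leaves t1 ++ leaves t2 by rewrite -(perm_mem perm_L) mem_head.
suff x2 : x \notin leaves t2 by split=> //; rewrite mem_cat (negPf x2) orbF in x12.
apply/negP => /min_leaf_le /(leq_trans lt12); have [i i1 ->] := min_leaf_mem t10.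
rewrite ltnNge (ordered_head ordL) //.
by rewrite (perm_mem perm_L) mem_cat i1.
Qed.

Lemma min_leaf_neq g t1 t2 d1 d2 :
  well_coloured chi t1 d1 -> well_coloured chi t2 d2 ->
  uniq (leaves (nd g [:: t1; t2])) -> min_leaf t1 != min_leaf t2.
Proof.
move=> w1 w2; rewrite /= cats0 cat_uniq => /and3P[_ disj _].
have [i i1 ->] := min_leaf_mem (size_leaves_gt0 shuffle_inputs_neq0 w1).
have [j j2 ->] := min_leaf_mem (size_leaves_gt0 shuffle_inputs_neq0 w2).
by apply: contraNneq disj => /val_inj ij; apply/hasP; exists j; rewrite // -ij.
Qed.

Lemma well_coloured_A_inv t : well_coloured chi t A ->
  [\/ exists2 y, t = Leaf y & chi y = A,
      exists a b, [/\ t = nd ShAlpha [:: a; b], well_coloured chi a A &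
        well_coloured chi b A] |
      exists2 s, t = nd ShI [:: s] & well_coloured chi s J].
Proof.
case: t => [y /= /eqP|g ts /=]; first by constructor 1; exists y.
case: g => /=; rewrite ?andFb //; case: ts => [|a [|b [|? ?]]] //=; rewrite ?andbF ?andbT //.
  by move=> /andP[wa wb]; constructor 2; exists a, b.
by move=> wa; constructor 3; exists a.
Qed.

Lemma well_coloured_J_inv t : well_coloured chi t J ->
  [\/ exists2 y, t = Leaf y & chi y = J,
      exists a b, [/\ t = nd ShL [:: a; b], well_coloured chi a A &
        well_coloured chi b J] |
      exists a b, [/\ t = nd ShR [:: a; b], well_coloured chi a J &
        well_coloured chi b A]].
Proof.
case: t => [y /= /eqP|g ts /=]; first by constructor 1; exists y.
case: g => /=; rewrite ?andFb //; case: ts => [|a [|b [|? ?]]] //=; rewrite ?andbF ?andbT //.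
  by move=> /andP[wa wb]; constructor 2; exists a, b.
by move=> /andP[wa wb]; constructor 3; exists a, b.
Qed.

Lemma increasing2 g (a b : tree shuffle_sig 'I_n) :
  increasing (nd g [:: a; b]) =
  [&& (min_leaf a < min_leaf b)%N, increasing a & increasing b].
Proof. by rewrite /= !andbT. Qed.

Lemma reducible_unary g h d a b :
  (exists psi, leading_monomial K psi d
     (nd g [:: nd h [:: Leaf (@Ordinal 2 0 isT); Leaf (@Ordinal 2 1 isT)]])) ->
  well_coloured chi (nd g [:: nd h [:: a; b]]) d ->
  (min_leaf a < min_leaf b)%N -> reducible K chi (nd g [:: nd h [:: a; b]]).
Proof.
move=> L2 wt ab.
apply: (reducible_graft (tau := fun i => nth a [:: a; b] i) L2 wt).
by move=> [[|[|i]] //= ?] [[|[|j]] //= ?] //=.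
Qed.

(** A vertex of output colour [J] is [l] or [r], and both [i l] and [i r] are leading. The bound on
    the words feeds the comparison with the comb. *)
Lemma reducible_i s : well_coloured chi s J -> increasing s ->
  (exists2 y, s = Leaf y & chi y = J) \/
  reducible K chi (nd ShI [:: s]) /\ forall x, (0 < size (path_word x s))%N.
Proof.
move=> /well_coloured_J_inv[[y ? ?]|[a [b [-> wa wb]]]|[a [b [-> wa wb]]]].
- by left; exists y.
- rewrite increasing2 => /and3P[ab _ _]; right; split=> //.
  apply: reducible_unary (leading_i_l K) _ ab.
  by rewrite /= wa wb.
- rewrite increasing2 => /and3P[ab _ _]; right; split=> //.
  apply: reducible_unary (leading_i_r K) _ ab.
  by rewrite /= wa wb.
Qed.

Lemma reducible_l_i s e :
  well_coloured chi (nd ShL [:: nd ShI [:: s]; e]) J ->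
  increasing (nd ShL [:: nd ShI [:: s]; e]) ->
  reducible K chi (nd ShL [:: nd ShI [:: s]; e]).
Proof.
move=> wt; rewrite increasing2 => /and3P[lt_se _ _].
apply: (reducible_graft (tau := fun i => nth s [:: s; e] i) (leading_l_i K) wt).
move: lt_se; rewrite /min_leaf /= cats0 => lt_se.
by move=> [[|[|i]] //= ?] [[|[|j]] //= ?] //=.
Qed.

Lemma reducible_left g h d a b e da db de :
  (exists psi, leading_monomial K psi d (nd g [:: nd h
     [:: Leaf (@Ordinal 3 0 isT); Leaf (@Ordinal 3 1 isT)]; Leaf (@Ordinal 3 2 isT)])) ->
  (exists psi, leading_monomial K psi d (nd g [:: nd h
     [:: Leaf (@Ordinal 3 0 isT); Leaf (@Ordinal 3 2 isT)]; Leaf (@Ordinal 3 1 isT)])) ->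
  well_coloured chi a da -> well_coloured chi b db -> well_coloured chi e de ->
  well_coloured chi (nd g [:: nd h [:: a; b]; e]) d ->
  uniq (leaves (nd g [:: nd h [:: a; b]; e])) ->
  increasing (nd g [:: nd h [:: a; b]; e]) ->
  reducible K chi (nd g [:: nd h [:: a; b]; e]).
Proof.
move=> L12 L13 wa wb we wt U inc; apply: reducible_left_comb L12 L13 wt _ _ inc.
  exact: (size_leaves_gt0 shuffle_inputs_neq0 wa).
apply: (min_leaf_neq (g := g) wb we); move: U.
by rewrite /= !cats0 -catA cat_uniq => /and3P[].
Qed.

(** A leaf of colour [J] cannot itself be an argument of colour [A], so a second vertex lies on its
    path. *)
Lemma path_word2_gt0 g a b x : x \in leaves (nd g [:: a; b]) ->
  well_coloured chi a A -> well_coloured chi b A -> chi x = J ->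
  (1 < size (path_word x (nd g [:: a; b])))%N.
Proof.
rewrite /= !cats0 mem_cat ltnS size_cat addn_gt0 => + wa wb xJ.
case/orP => xin; rewrite xin; first by rewrite (path_word_gt0 wa xin xJ).
by rewrite (path_word_gt0 wb xin xJ) orbT.
Qed.

Lemma path_word_unary g s x : x \in leaves s ->
  path_word x (nd g [:: s]) = g :: path_word x s.
Proof. by move=> /= ->; rewrite cats0. Qed.

(** The smallest label [x] lies in the left child of a binary root. If that child is [x] or [i]
    applied to [x], the root and the word of [x] are those of the comb, and induction applies to the
    right child. Otherwise the left child exhibits a leading monomial and makes the word of [x]
    exceed that of the comb. A root [i] above a proper tree behaves likewise. *)
Lemma comb_or_reducibleP t c x L :
  well_coloured chi t c -> increasing t -> ordered (x :: L) ->
  perm_eq (x :: L) (leaves t) -> comb_or_reducible c x L t.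
Proof.
have [m] := ubnP (nvertices t); elim: m t c x L => // m IH t c x L.
rewrite ltnS => tm wt inc ordL Lt; have U := ordered_uniq ordL.
have leaf y : leaves t = [:: y] -> x = y /\ L = [::].
  move=> et; rewrite et in Lt; have := perm_size Lt.
  case: L Lt {ordL U} => // Lt _; split=> //.
  by move: (perm_mem Lt y); rewrite !inE eqxx => /eqP.
(* The induction step packaged for any binary root, so that only the shape of the left child remains
   to be examined. *)
have binary g t1 t2 d1 d2 : t = nd g [:: t1; t2] ->
    well_coloured chi t1 d1 -> well_coloured chi t2 d2 ->
    [/\ x \in leaves t1, x \notin leaves t2, min_leaf t1 != min_leaf t2 &
        exists y L', L = y :: L' /\ (leaves t1 = [:: x] ->
          comb c x (y :: L') = nd g [:: t1; comb d2 y L'] ->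
          comb_or_reducible c x L t)].
  move=> et w1 w2; rewrite et in inc Lt; move: (inc); rewrite increasing2.
  case/and3P=> m12 i1 i2.
  have t10 := size_leaves_gt0 shuffle_inputs_neq0 w1.
  have t20 := size_leaves_gt0 shuffle_inputs_neq0 w2.
  have [xt1 xt2] := ordered_leaves (g := g) t10 ordL Lt inc; split=> //.
    by apply: (min_leaf_neq (g := g) w1 w2); rewrite -(perm_uniq Lt).
  have : (1 < size (x :: L))%N.
    by rewrite (perm_size Lt) /= cats0 size_cat; exact: leq_add t10 t20.
  case: L ordL Lt {U leaf} => [//|y L'] ordL Lt _; exists y, L'; split=> // l1 ec.
  have Lt2 : perm_eq (y :: L') (leaves t2).
    by move: Lt; rewrite /= cats0 l1 perm_cons.
  rewrite et; apply: (comb_or_reducible_right ordL l1 Lt2 ec).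
  apply: IH => //; last exact: ordered_tail ordL.
  by apply: leq_trans tm; rewrite et /= addn0 ltnS leq_addl.
case: c wt binary => wt binary.
  case/well_coloured_A_inv: (wt) => [[y et yA]|[t1 [t2 [et w1 w2]]]|[s et ws]].
  - by have [|-> ->] := leaf y; rewrite et //; left; rewrite /= /a_leaf yA.
  - have [xt1 xt2 neq [y [L' [eL right]]]] := binary _ _ _ _ _ et w1 w2.
    subst t L; move: (inc); rewrite increasing2 => /and3P[m12 i1 i2].
    (* The comb has the word [alpha] for [x] of colour [A], and [alpha i] for colour [J]: below the
       root, [t1] must contribute more than zero, respectively more than one letter. *)
    have bad : (chi x = J -> 1 < size (path_word x t1))%N ->
        (0 < size (path_word x t1))%N -> reducible K chi (nd ShAlpha [:: t1; t2]) ->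
        comb_or_reducible A x (y :: L') (nd ShAlpha [:: t1; t2]).
      move=> s1 s0 red; apply: comb_or_reducible_head red.
      rewrite (path_word_comb_head _ U) (path_word_left ShAlpha xt1 xt2).
      by case ex: (chi x); rewrite /deglex_lt /= ?ltnS ?s0 // s1.
    case/well_coloured_A_inv: (w1) => [[z e1 zA]|[a [b [e1 wa wb]]]|[s e1 ws]];
      subst t1.
    + move: xt1; rewrite inE => /eqP xz; subst z; apply: right => //.
      by rewrite /= /a_leaf zA.
    + apply: bad => // [xJ|]; first exact: path_word2_gt0.
      apply: (reducible_left (leading_alpha_alpha12 K) (leading_alpha_alpha13 K)
        wa wb w2 wt _ inc).
      by rewrite -(perm_uniq Lt).
    + have xs : x \in leaves s by move: xt1; rewrite /= cats0.
      have is_ : increasing s by move: i1; rewrite /= andbT.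
      case: (reducible_i ws is_) => [[z e1 zJ]|[red s0]].
        subst s; move: xs; rewrite inE => /eqP xz; subst z; apply: right => //.
        by rewrite /= /a_leaf zJ.
      apply: bad => // [xJ|].
        by rewrite (path_word_unary ShI xs) /= ltnS.
      by apply: reducible_child red _; rewrite inE eqxx.
  - have is_ : increasing s by move: inc; rewrite et /= andbT.
    case: (reducible_i ws is_) => [[z e1 zJ]|[red s0]].
      have [|-> ->] := leaf z; first by rewrite et e1.
      by left; rewrite et e1 /= /a_leaf zJ.
    (* The word of [x] starts with [i] and has at least two letters; the comb has a shorter word, or
       [alpha i], which is smaller since [alpha < i]. *)
    rewrite et; apply: comb_or_reducible_head red.
    have xs : x \in leaves s.
      by move: (perm_mem Lt x); rewrite et mem_head /= cats0 => <-.
    rewrite (path_word_unary ShI xs); move: (s0 x) U; case: (path_word x s) => // o w _.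
    case: L {ordL Lt leaf binary} => [|y L] U; last first.
      by rewrite (path_word_comb_head _ U); case: (chi x); case: w.
    by rewrite /= /a_leaf; case: (chi x) => //=; rewrite inE eqxx; case: w.
case/well_coloured_J_inv: (wt) => [[y et yA]|[t1 [t2 [et w1 w2]]]|[t1 [t2 [et w1 w2]]]].
- by have [|-> ->] := leaf y; rewrite et //; left.
- have [xt1 xt2 neq [y [L' [eL right]]]] := binary _ _ _ _ _ et w1 w2.
  subst t L; move: (inc); rewrite increasing2 => /and3P[m12 i1 i2].
  (* In colour [J] the comb reaches [x] by a single letter, so any vertex in [t1] makes the word
     longer. *)
  have bad : (0 < size (path_word x t1))%N -> reducible K chi (nd ShL [:: t1; t2]) ->
      comb_or_reducible J x (y :: L') (nd ShL [:: t1; t2]).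
    move=> s0 red; apply: comb_or_reducible_head red.
    rewrite (path_word_comb_head _ U) (path_word_left ShL xt1 xt2).
    by case: (chi x); rewrite /deglex_lt /= ltnS s0.
  case/well_coloured_A_inv: (w1) => [[z e1 zA]|[a [b [e1 wa wb]]]|[s e1 ws]];
    subst t1.
  + by move: xt1; rewrite inE => /eqP xz; subst z; apply: right => //=; rewrite zA.
  + apply: bad => //.
    apply: (reducible_left (leading_l_alpha12 K) (leading_l_alpha13 K)
      wa wb w2 wt _ inc).
    by rewrite -(perm_uniq Lt).
  + by apply: bad => //; apply: reducible_l_i.
- have [xt1 xt2 neq [y [L' [eL right]]]] := binary _ _ _ _ _ et w1 w2.
  subst t L; move: (inc); rewrite increasing2 => /and3P[m12 i1 i2].
  have bad : (0 < size (path_word x t1))%N -> reducible K chi (nd ShR [:: t1; t2]) ->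
      comb_or_reducible J x (y :: L') (nd ShR [:: t1; t2]).
    move=> s0 red; apply: comb_or_reducible_head red.
    rewrite (path_word_comb_head _ U) (path_word_left ShR xt1 xt2).
    by case: (chi x); rewrite /deglex_lt /= ltnS s0.
  case/well_coloured_J_inv: (w1) =>
    [[z e1 zJ]|[a [b [e1 wa wb]]]|[a [b [e1 wa wb]]]]; subst t1.
  + by move: xt1; rewrite inE => /eqP xz; subst z; apply: right => //=; rewrite zJ.
  + apply: bad => //.
    apply: (reducible_left (leading_r_l12 K) (leading_r_l13 K) wa wb w2 wt _ inc).
    by rewrite -(perm_uniq Lt).
  + apply: bad => //.
    apply: (reducible_left (leading_r_r12 K) (leading_r_r13 K) wa wb w2 wt _ inc).
    by rewrite -(perm_uniq Lt).
Qed.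

End NormalForm.

(** * The quadratic Groebner basis *)

Section Groebner.
Variable K : fieldType.

Lemma sorted_enum_ord n : sorted (fun i j : 'I_n => (i < j)%N) (enum 'I_n).
Proof.
have : sorted ltn (map val (enum 'I_n)) by rewrite val_enum_ord iota_ltn_sorted.
by rewrite sorted_map.
Qed.

Lemma shuffle_op_lt_trans : transitive shuffle_op_lt.
Proof. by move=> g h k; apply: ltn_trans. Qed.

Lemma shuffle_op_lt_trichotomous : trichotomous shuffle_op_lt.
Proof. by case=> [] []. Qed.

Lemma path_lex_lt_irr n (t : tree shuffle_sig 'I_n) :
  path_lex_lt shuffle_op_lt t t = false.
Proof.
have lex_irr (T : eqType) (lt : rel T) s : (forall x, lt x x = false) ->
    lex_lt lt s s = false.
  by move=> irr; elim: s => //= x s ->; rewrite irr andbF.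
rewrite /path_lex_lt !lex_irr ?andbF // => [i|w]; first exact: ltnn.
rewrite /deglex_lt ltnn eqxx lex_irr // => g; exact: ltnn.
Qed.

(** Both monomials are compared with the same comb: an irreducible [t] is that comb, and [s] is the
    comb or larger. *)
Lemma irreducible_minimal n (chi : {ffun 'I_n -> colour}) c
    (s t : tree shuffle_sig 'I_n) :
  shuffle_monomial chi c s -> shuffle_monomial chi c t ->
  reducible K chi t \/ s = t \/ path_lex_lt shuffle_op_lt t s.
Proof.
move=> /andP[/andP[ws sn] is_] /andP[/andP[wt tn] it].
have : (0 < size (enum 'I_n))%N.
  by rewrite -(perm_size tn) (size_leaves_gt0 shuffle_inputs_neq0 wt).
have := sorted_enum_ord n; case en: (enum 'I_n) => [//|x L] ord_xL _.
have Ls : perm_eq (x :: L) (leaves s) by rewrite -en perm_sym.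
have Lt : perm_eq (x :: L) (leaves t) by rewrite -en perm_sym.
case: (comb_or_reducibleP K wt it ord_xL Lt) => [et|[_ ?]]; last by left.
case: (comb_or_reducibleP K ws is_ ord_xL Ls) => [es|[lt_s _]]; right.
  by left; rewrite es et.
by right; rewrite /path_lex_lt /path_vector en et; apply/orP; left.
Qed.

Lemma shuffle_icom_groebner :
  is_groebner_basis shuffle_op_lt
    (@shuffle_icom_ideal K) (@shuffle_icom_relation K).
Proof.
split=> // n chi c f /shuffle_icom_ideal_zero_sum[/allP domf f0] fn0.
have [|||t tf tmax] := @max_seq _ (@path_lex_lt _ _ shuffle_op_lt n) (dom f).
- exact: path_lex_lt_trans shuffle_op_lt_trans.
- move=> s t /domf /andP[ms _] /domf /andP[mt _].
  exact (path_lex_lt_trichotomous shuffle_inputs_neq0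
    shuffle_op_lt_trichotomous ms mt).
- by rewrite dom_eq0.
exists t => //; suff : reducible K chi t by [].
(* An irreducible [t] would be minimal as well as maximal, hence alone in the support. *)
have irr s : s \in dom f -> reducible K chi t \/ s = t.
  move=> sf; have [->|st] := eqVneq s t; first by right.
  have [|[|lt_ts]] := irreducible_minimal (domf s sf) (domf t tf); [by left|by right|].
  have := path_lex_lt_trans shuffle_op_lt_trans lt_ts (tmax s sf st).
  by rewrite path_lex_lt_irr.
have [/eqP ef|] := eqVneq (f - coeff t f *: << t >>) 0; last first.
  rewrite -dom_eq0; set h := f - _; case eh : (dom h) => [//|s r] _.
  have sh : s \in dom h by rewrite eh mem_head.
  have sf : s \in dom f.
    move/domB: (sh); rewrite mem_cat => /orP[//|/domZ_subset].
    by rewrite domU1 inE => /eqP ->.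
  (* [s] equals [t], whose coefficient in the difference [h] has been cancelled. *)
  have [//|st] := irr s sf; move: sh.
  by rewrite mem_dom coeffB coeffZ coeffU st eqxx !mulr1 subrr eqxx.
move: ef f0; rewrite subr_eq0 => /eqP ->.
rewrite linearZ /= coeff_sumU [LHS]mulr1 => tf0.
by move: tf; rewrite mem_dom tf0 eqxx.
Qed.

End Groebner.

(** * Congruence modulo a symmetric ideal *)

Lemma relabel_inj (G : eqType) X Y (f : X -> Y) :
  injective f -> injective (@relabel G X Y f).
Proof.
move=> inj_f; elim=> [x|g ts IH] [y|h us] //=; first by case=> /inj_f ->.
case=> <- E; congr (Node g _); elim: ts us IH E => [|t ts IHts] [|u us] //=.
by move=> [IHt /IHts IH] [/IHt -> /IH ->].
Qed.

Lemma permutation_of_lists (T : finType) (s1 s2 : seq T) :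
  perm_eq s1 (enum T) -> perm_eq s2 (enum T) ->
  exists2 p : T -> T, injective p & map p s1 = s2.
Proof.
move=> p1 p2; have U1 : uniq s1 by rewrite (perm_uniq p1) enum_uniq.
have U2 : uniq s2 by rewrite (perm_uniq p2) enum_uniq.
have sz : size s1 = size s2 by rewrite (perm_size p1) (perm_size p2).
have m1 x : x \in s1 by rewrite (perm_mem p1) mem_enum.
exists (fun x => nth x s2 (index x s1)) => [x y|].
  rewrite (set_nth_default y) -?sz ?index_mem // => /eqP.
  by rewrite nth_uniq -?sz ?index_mem // => /eqP; apply: index_inj.
case: s1 {p1} U1 sz m1 => [|x0 s1] U1 sz m1; first by case: s2 sz {p2 U2}.
apply: (@eq_from_nth _ x0); rewrite size_map // => i ilt.
by rewrite (nth_map x0) // index_uniq //; apply: set_nth_default; rewrite -sz.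
Qed.

Section SymIdeal.
Variables (K : fieldType) (I : eqType) (S : signature I).
Variable M : Defs.family K S.
Hypothesis idealM : is_sym_ideal M.

Lemma ideal0 n (chi : {ffun 'I_n -> I}) c : M chi c 0.
Proof. by have [subM _ _] := idealM; have [] := subM n chi c. Qed.

Lemma idealZ n (chi : {ffun 'I_n -> I}) c (a : K) f : M chi c f -> M chi c (a *: f).
Proof.
have [subM _ _] := idealM; have [_ M0 MD] := subM n chi c => Mf.
by have := MD a f 0 Mf M0; rewrite addr0.
Qed.

Lemma idealD n (chi : {ffun 'I_n -> I}) c f g :
  M chi c f -> M chi c g -> M chi c (f + g).
Proof.
have [subM _ _] := idealM; have [_ _ MD] := subM n chi c => Mf Mg.
by have := MD 1 f g Mf Mg; rewrite scale1r.
Qed.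

(** Any bijective labelling differs from that of the partial composition by a permutation of the
    labels, which the symmetric action supplies. [N] is free because [eqv_subst] meets an arbitrary
    number of labels; counting then forces its value. *)
Lemma ideal_comp n m N (l : 'I_n.+1) (u : 'I_n.+1 -> 'I_N) (v : 'I_m.+1 -> 'I_N)
    (chi : {ffun 'I_n.+1 -> I}) (psi : {ffun 'I_m.+1 -> I}) omega c f g :
  bijective_labelling l u v -> comp_colouring l u v chi psi omega ->
  (M chi c f /\ free_sym psi (chi l) g) \/ (free_sym chi c f /\ M psi (chi l) g) ->
  M omega c (comp_elt l u v f g).
Proof.
move=> luv [ou ov] fg; have [_ symM compM] := idealM.
have eN : N = (n + m).+1.
  have rem_l : size (rem l (enum 'I_n.+1)) = n.
    by rewrite size_rem ?mem_enum // size_enum_ord.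
  have := perm_size luv; rewrite size_cat (size_map v) (size_map u) rem_l.
  by rewrite !size_enum_ord => <-; rewrite addSn addnC.
subst N; have [p inj_p] := permutation_of_lists (composition_labelling m l) luv.
rewrite map_cat -(map_comp p (outer_label m l)) -(map_comp p (inner_label l)).
move=> /eqP; rewrite eqseq_cat; last by rewrite !size_map.
case/andP => /eqP/eq_in_map pv /eqP/eq_in_map pu.
have {}pv j : p (inner_label l j) = v j by apply: pv; rewrite mem_enum.
have {}pu i : i != l -> p (outer_label m l i) = u i.
  by move=> il; apply: pu; rewrite mem_rem_uniq ?enum_uniq // inE il mem_enum.
pose omega' := [ffun k => omega (p k)].
pose sigma := (perm inj_p)^-1%g.
have -> : omega = perm_colouring sigma omega'.
  by apply/ffunP => k; rewrite !ffunE -(permE inj_p) permKV.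
have -> : comp_elt l u v f g =
    sym_act sigma (comp_elt l (outer_label m l) (@inner_label n m l) f g).
  rewrite /sym_act /relabel_elt /comp_elt fglift_comp; apply: eq_fglift => s.
  rewrite fglift_comp; apply: eq_fglift => t.
  rewrite /= fgliftU; congr (<< _ >>); rewrite /comp_tree /relabel graft_graft.
  apply: eq_in_graft => i _; case: eqP => [_|/eqP il].
    rewrite -!/(relabel _ _) relabel_comp; apply: eq_in_graft => j _.
    by rewrite /= invgK permE pv.
  by rewrite /= invgK permE pu.
apply: symM; apply: (compM _ _ _ _ _ _ _ _ _ _ _ _ _ fg) => //.
by split=> [i il|j]; rewrite ffunE ?pu ?pv ?ou ?ov.
Qed.

End SymIdeal.

(** * Congruence of trees with arbitrary labels *)

Section Congruence.
Variables (K : fieldType) (I : eqType) (S : signature I).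
Variable M : Defs.family K S.
Hypothesis idealM : is_sym_ideal M.
Hypothesis inputs_neq0 : forall g : S, inputs g != [::].

(* Subtrees have leaves in a subset of the labels, so trees are compared over an
   arbitrary type of labels, through all their relabellings by ['I_n]. *)
Definition eqv (X : eqType) (chi : X -> I) c (t t' : tree S X) :=
  [/\ well_coloured chi t c, well_coloured chi t' c,
      perm_eq (leaves t) (leaves t') &
      uniq (leaves t) -> forall n (h : 'I_n -> X) t0 t0',
        perm_eq (leaves t0) (enum 'I_n) -> relabel h t0 = t -> relabel h t0' = t' ->
        M [ffun i => chi (h i)] c (<< t0 >> - << t0' >>)].

(** This is what the guard [uniq (leaves t)] in [eqv] provides: numberings are injective, so a tree
    has one representative for each of them. The guard also spares the congruence lemmas any
    disjointness hypothesis. *)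
Lemma relabelling_inj_uniq n (X : eqType) (h : 'I_n -> X) (t : tree S 'I_n) :
  perm_eq (leaves t) (enum 'I_n) -> uniq (leaves (relabel h t)) -> injective h.
Proof.
rewrite leaves_relabel => tn; rewrite (perm_uniq (perm_map h tn)) => U.
exact/injectiveP.
Qed.

Lemma relabel_lift_mem (X Y : eqType) (h : X -> Y) (t : tree S Y) :
  {in leaves t, forall y, exists x, h x = y} -> exists t', relabel h t' = t.
Proof.
move=> ht; apply: relabel_lift => y yt; apply: ht.
by elim: (leaves t) yt => //= z s IH [->|/IH]; rewrite inE ?eqxx // => ->; rewrite orbT.
Qed.

(** The leaves are numbered from left to right. There is at least one, which gives the shape [m.+1]
    that compositions require. *)
Lemma standardize (X : eqType) (chi : X -> I) c (t : tree S X) :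
  well_coloured chi t c -> uniq (leaves t) ->
  exists m (v : 'I_m.+1 -> X) t0, [/\ injective v, relabel v t0 = t &
    perm_eq (leaves t0) (enum 'I_m.+1)].
Proof.
move=> wt U; have := size_leaves_gt0 inputs_neq0 wt.
case em : (size (leaves t)) => [//|m] _.
have szt : size (leaves t) == m.+1 by rewrite em.
pose v := tnth (Tuple szt).
have inj_v : injective v by apply/tuple_uniqP.
have [t0 et] : exists t0, relabel v t0 = t.
  apply: relabel_lift_mem => y yt.
  have /tnthP[i ->] : y \in Tuple szt by [].
  by exists i.
exists m, v, t0; split=> //.
have map_inj : injective (map v) by apply: inj_map.
rewrite (_ : leaves t0 = enum 'I_m.+1) //; apply: map_inj.
by rewrite -leaves_relabel et map_tnth_enum.
Qed.

Lemma standardize_perm (X : eqType) m (v : 'I_m -> X) (t t' : tree S X) t0 :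
  injective v -> relabel v t0 = t -> perm_eq (leaves t0) (enum 'I_m) ->
  perm_eq (leaves t) (leaves t') ->
  exists2 t0', relabel v t0' = t' & perm_eq (leaves t0') (enum 'I_m).
Proof.
move=> inj_v et tm tt'; have [t0' et'] : exists t0', relabel v t0' = t'.
  apply: relabel_lift_mem => y; rewrite -(perm_mem tt') -et leaves_relabel.
  by case/mapP => x _ ->; exists x.
exists t0' => //; apply: perm_trans tm; rewrite perm_sym.
by apply: (perm_map_inj inj_v); rewrite -!leaves_relabel et et'.
Qed.

Section Eqv.
Variables (X : eqType) (chi : X -> I).
Implicit Types t : tree S X.

Lemma eqv_refl c t : well_coloured chi t c -> eqv chi c t t.
Proof.
move=> wt; split=> // U n h t0 t0' tn et et'.
have inj_h : injective h.
  by apply: (@relabelling_inj_uniq _ _ _ t0) => //; rewrite et.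
have -> : t0 = t0' by apply: (relabel_inj inj_h); rewrite et et'.
by rewrite subrr; apply: ideal0.
Qed.

Lemma eqv_sym c t t' : eqv chi c t t' -> eqv chi c t' t.
Proof.
move=> [wt wt' tt' E]; split=> //; first by rewrite perm_sym.
rewrite -(perm_uniq tt') => U n h t0' t0 tn' et' et.
have inj_h : injective h.
  by apply: (@relabelling_inj_uniq _ _ _ t0') => //; rewrite et' -(perm_uniq tt').
rewrite -opprB -scaleN1r; apply: idealZ => //; apply: E => //.
apply: perm_trans tn'.
by apply: (perm_map_inj inj_h); rewrite -!leaves_relabel et et'.
Qed.

Lemma eqv_trans c t2 t1 t3 : eqv chi c t1 t2 -> eqv chi c t2 t3 -> eqv chi c t1 t3.
Proof.
move=> [w1 w2 p12 E12] [_ w3 p23 E23]; split=> //; first exact: perm_trans p23.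
move=> U n h s1 s3 sn e1 e3.
have inj_h : injective h.
  by apply: (@relabelling_inj_uniq _ _ _ s1) => //; rewrite e1.
have [s2 e2 sn2] := standardize_perm inj_h e1 sn p12.
rewrite -(subrKA << s2 >>); apply: idealD => //; first exact: E12.
by apply: E23 => //; rewrite -(perm_uniq p12).
Qed.

End Eqv.

Lemma uniq_flatten_subst (X : eqType) y (r s : seq X) :
  r != [::] -> uniq (flatten [seq if x == y then r else [:: x] | x <- s]) -> uniq s.
Proof.
move=> r0; elim: s => //= x s IH; rewrite cat_uniq => /and3P[_ disj /IH ->].
rewrite andbT; apply: contraNN disj => xs.
have [z zr] : exists z, z \in (if x == y then r else [:: x]).
  case: ifP => _; last by exists x; rewrite mem_head.
  by case: (r) r0 => // z r' _; exists z; rewrite mem_head.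
apply/hasP; exists z => //; apply/flattenP.
by exists (if x == y then r else [:: x]) => //; apply/mapP; exists x.
Qed.

Definition subst (X : eqType) (y : X) (s : tree S X) : tree S X -> tree S X :=
  graft (fun x => if x == y then s else Leaf x).

Lemma leaves_subst (X : eqType) y (s t : tree S X) :
  leaves (subst y s t) = flatten [seq if x == y then leaves s else [:: x] | x <- leaves t].
Proof.
rewrite leaves_graft; congr flatten; apply: eq_map => x; by case: ifP.
Qed.

Lemma perm_leaves_subst (X : eqType) y (s s' t t' : tree S X) :
  perm_eq (leaves s) (leaves s') -> perm_eq (leaves t) (leaves t') ->
  perm_eq (leaves (subst y s t)) (leaves (subst y s' t')).
Proof.
move=> ss' tt'; rewrite !leaves_subst.
apply: perm_trans (perm_flatten (perm_map _ tt')) _.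
elim: (leaves t') => //= x r IH; apply: perm_cat => //.
by case: ifP.
Qed.

(** With substitution at [y] written as composition, this is the splitting of [t o s - t' o s'] into
    [(t - t') o s] and [t' o (s - s')], both in the ideal. *)
Lemma eqv_subst (X : eqType) (chi : X -> I) c y t t' s s' :
  y \in leaves t -> eqv chi c t t' -> eqv chi (chi y) s s' ->
  eqv chi c (subst y s t) (subst y s' t').
Proof.
move=> yt [wt wt' tt' Et] [ws ws' ss' Es].
have wsub r q : well_coloured chi r (chi y) -> well_coloured chi q c ->
    well_coloured chi (subst y r q) c.
  move=> wr; apply: well_coloured_graft => x _.
  by case: eqP => [->|_] //=.
split; [exact: wsub|exact: wsub|exact: perm_leaves_subst|].
move=> U n h r0 r0' rn er er'.
have s0 := size_leaves_gt0 inputs_neq0 ws.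
have Ut : uniq (leaves t).
  by move: U; rewrite leaves_subst; apply: uniq_flatten_subst; case: (leaves s) s0.
have sub_s : {subset leaves s <= leaves (subst y s t)}.
  move=> x xs; rewrite leaves_subst; apply/flattenP; exists (leaves s) => //.
  by apply/mapP; exists y; rewrite ?eqxx.
have sub_t x : x \in leaves t -> x != y -> x \in leaves (subst y s t).
  move=> xt xy; rewrite leaves_subst; apply/flattenP; exists [:: x]; rewrite ?inE //.
  by apply/mapP; exists x; rewrite ?(negPf xy).
have Us : uniq (leaves s).
  have := leaves_subst y s t; have /perm_to_rem yrem := yt.
  move=> els; move: U; rewrite els (perm_uniq (perm_flatten (perm_map _ yrem))) /=.
  by rewrite eqxx cat_uniq => /and3P[].
have inj_h : injective h.
  by apply: (@relabelling_inj_uniq _ _ _ r0) => //; rewrite er.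
have hsurj x : x \in leaves (subst y s t) -> exists i, h i = x.
  by rewrite -er leaves_relabel => /mapP[i _ ->]; exists i.
have [a [vt [t1 [inj_vt et tm]]]] := standardize wt Ut.
have [b [vs [s1 [inj_vs es sm]]]] := standardize ws Us.
have [t1' et' tm'] := standardize_perm inj_vt et tm tt'.
have [s1' es' sm'] := standardize_perm inj_vs es sm ss'.
have [l yl] : exists l, vt l = y.
  by move: yt; rewrite -et leaves_relabel => /mapP[l _ ->]; exists l.
have /fin_all_exists[v hv] (j : 'I_b.+1) : exists k, h k = vs j.
  apply: hsurj; apply: sub_s.
  by rewrite -es leaves_relabel map_f // (perm_mem sm) mem_enum.
(* The label [y] need not occur after the substitution, so [u] is constrained only away from [l];
   [v ord0] is an arbitrary value there. *)
have /fin_all_exists[u hu] (i : 'I_a.+1) : exists k, i != l -> h k = vt i.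
  have [->|il] := eqVneq i l.
    by exists (v ord0).
  have [|k hk] := hsurj (vt i); last by exists k.
  apply: sub_t; first by rewrite -et leaves_relabel map_f // (perm_mem tm) mem_enum.
  by rewrite -yl (inj_eq inj_vt).
have comp_treeE p q : relabel h (comp_tree l u v p q) =
    subst y (relabel vs q) (relabel vt p).
  rewrite /comp_tree /relabel /subst !graft_graft.
  apply: eq_in_graft => i _; rewrite /= -yl (inj_eq inj_vt).
  case: eqP => [_|/eqP /hu /= -> //]; rewrite graft_graft.
  by apply: eq_in_graft => j _; rewrite /= hv.
have er0 : r0 = comp_tree l u v t1 s1.
  by apply: (relabel_inj inj_h); rewrite er comp_treeE es et.
have er0' : r0' = comp_tree l u v t1' s1'.
  by apply: (relabel_inj inj_h); rewrite er' comp_treeE es' et'.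
(* Read off from the fact that the composite [r0] uses every label exactly once. *)
have luv : bijective_labelling l u v.
  by rewrite -(perm_leaves_comp_tree l u v tm sm) -er0.
pose chi_t : {ffun _} := [ffun i => chi (vt i)].
pose chi_s : {ffun _} := [ffun i => chi (vs i)].
have col : comp_colouring l u v chi_t chi_s [ffun i => chi (h i)].
  by split=> [i il|j]; rewrite !ffunE ?hu ?hv.
have chi_l : chi_t l = chi y by rewrite ffunE yl.
have Mt := Et Ut _ vt _ _ tm et et'; have Ms := Es Us _ vs _ _ sm es es'.
have sym_s1 : free_sym chi_s (chi_t l) (<< s1 >> : elt K S _).
  rewrite /free_sym all_domU /sym_monomial sm andbT chi_l.
  rewrite -(@eq_in_well_coloured _ _ _ (chi \o vs)) => [|i _]; last by rewrite ffunE.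
  by rewrite -well_coloured_relabel es.
have sym_t1' : free_sym chi_t c (<< t1' >> : elt K S _).
  rewrite /free_sym all_domU /sym_monomial tm' andbT.
  rewrite -(@eq_in_well_coloured _ _ _ (chi \o vt)) => [|i _]; last by rewrite ffunE.
  by rewrite -well_coloured_relabel et'.
have compU p q : comp_elt l u v << p >> << q >> = << comp_tree l u v p q >> :> elt K S n.
  by rewrite /comp_elt !fgliftU.
have M1 := ideal_comp idealM luv col (or_introl (conj Mt sym_s1)).
have M2 : M [ffun i => chi (h i)] c (comp_elt l u v << t1' >> (<< s1 >> - << s1' >>)).
  by apply: (ideal_comp idealM luv col); right; rewrite chi_l.
have compBl p p' q : comp_elt l u v (p - p') q =
    comp_elt l u v p q - comp_elt l u v p' q :> elt K S n.
  exact: fgliftB.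
have compBr p q q' : comp_elt l u v << p >> (q - q') =
    comp_elt l u v << p >> q - comp_elt l u v << p >> q' :> elt K S n.
  by rewrite /comp_elt !fgliftU fgliftB.
rewrite compBl !compU in M1; rewrite compBr !compU in M2.
by rewrite er0 er0' -(subrKA << comp_tree l u v t1' s1 >>); apply: idealD.
Qed.

End Congruence.

Section Substitution.
Variables (K : fieldType) (I : eqType) (S : signature I).
Variable M : Defs.family K S.
Hypothesis idealM : is_sym_ideal M.
Hypothesis inputs_neq0 : forall g : S, inputs g != [::].

(** Numberings of the relabelled leaves and of the original ones correspond through [f]; used for
    the two injections into [X + Y]. *)
Lemma eqv_relabel (X Y : eqType) (f : X -> Y) (psi : Y -> I) c (t t' : tree S X) :
  injective f ->
  eqv M psi c (relabel f t) (relabel f t') <-> eqv M (psi \o f) c t t'.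
Proof.
move=> inj_f; split=> [] [wt wt' tt' E].
  split; [by rewrite -well_coloured_relabel|by rewrite -well_coloured_relabel| |].
    by apply: (perm_map_inj inj_f); rewrite -!leaves_relabel.
  move=> U n h t0 t0' tn et et'.
  apply: (E _ n (f \o h)) => //; rewrite ?leaves_relabel ?map_inj_uniq //.
    by rewrite -relabel_comp et.
  by rewrite -relabel_comp et'.
split; rewrite ?well_coloured_relabel // ?leaves_relabel ?perm_map //.
rewrite map_inj_uniq // => U n h t0 t0' tn et et'.
have /fin_all_exists[k hk] (i : 'I_n) : exists x, f x = h i.
  have : h i \in leaves (relabel h t0).
    by rewrite leaves_relabel map_f // (perm_mem tn) mem_enum.
  by rewrite et leaves_relabel => /mapP[x _ ->]; exists x.
have fk (s : tree S 'I_n) : relabel f (relabel k s) = relabel h s.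
  by rewrite relabel_comp; apply: eq_in_graft => i _; rewrite /= hk.
rewrite (_ : [ffun i => _] = [ffun i => (psi \o f) (k i)]); last first.
  by apply/ffunP => i; rewrite !ffunE /= hk.
by apply: E => //; apply: (relabel_inj inj_f); rewrite fk.
Qed.

(* The leaves are substituted one at a time, in trees labelled by [X + Y]: this
   keeps the labels still to be substituted apart from those already present. *)
Lemma eqv_graft (X Y : eqType) (chi : X -> I) (psi : Y -> I) c
    (t t' : tree S X) (f f' : X -> tree S Y) :
  eqv M chi c t t' ->
  {in leaves t, forall x, eqv M psi (chi x) (f x) (f' x)} ->
  eqv M psi c (graft f t) (graft f' t').
Proof.
move=> tt' ff'; have [wt wt' perm_t _] := tt'.
pose omega (z : X + Y) := match z with inl x => chi x | inr y => psi y end.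
pose part (F : X -> tree S Y) (r : seq X) (x : X) : tree S (X + Y)%type :=
  if x \in r then relabel inr (F x) else Leaf (inl x).
have inl_inj : injective (@inl X Y) by move=> ? ? [].
have inr_inj : injective (@inr X Y) by move=> ? ? [].
have sub r : uniq r -> {subset r <= leaves t} ->
    eqv M omega c (graft (part f r) t) (graft (part f' r) t').
  elim: r => [_ _|x r IH /andP[xr Ur] rt].
    by apply/(eqv_relabel _ _ _ _ inl_inj).
  have step F s : graft (part F (x :: r)) s =
      subst (inl x) (relabel inr (F x)) (graft (part F r) s).
    rewrite /subst graft_graft; apply: eq_in_graft => z _.
    rewrite /part inE; have [->|zx] := eqVneq z x; first by rewrite (negPf xr) /= eqxx.
    case: ifP => _ /=; last by rewrite (inj_eq inl_inj) (negPf zx).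
    by rewrite -[RHS]/(graft _ (graft _ _)) graft_graft.
  rewrite !step; apply: eqv_subst => //.
  - rewrite leaves_graft; apply/flattenP.
    exists [:: inl x]; rewrite ?inE //; apply/mapP; exists x.
      by apply: rt; rewrite mem_head.
    by rewrite /part (negPf xr).
  - by apply: IH => // z zr; apply: rt; rewrite inE zr orbT.
  - by apply/(eqv_relabel _ _ _ _ inr_inj)/ff'/rt/mem_head.
have := sub (undup (leaves t)) (undup_uniq _).
have part_all F s : perm_eq (leaves t) (leaves s) ->
    graft (part F (undup (leaves t))) s = relabel inr (graft F s).
  move=> ts; rewrite /relabel graft_graft; apply: eq_in_graft => x xs.
  by rewrite /part mem_undup (perm_mem ts) xs.
rewrite !part_all // => E; apply/(eqv_relabel omega _ _ _ inr_inj)/E => x.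
by rewrite mem_undup.
Qed.

(** Every other numbering of the leaves is a permutation of the given one, and the ideal is stable
    under permutations. *)
Lemma eqv_of_ideal n (chi : {ffun 'I_n -> I}) c (s t : tree S 'I_n) :
  sym_monomial chi c s -> sym_monomial chi c t ->
  M chi c (<< s >> - << t >>) -> eqv M chi c s t.
Proof.
move=> /andP[ws sn] /andP[wt tn] Mst.
have st : perm_eq (leaves s) (leaves t) by rewrite (perm_trans sn) // perm_sym.
split=> // U m h s0 t0 sm es et.
have inj_h : injective h.
  by apply: (@relabelling_inj_uniq _ _ _ _ _ s0) => //; rewrite es.
have emn : m = n.
  have := perm_size sm; rewrite size_enum_ord => <-.
  by rewrite -(size_map h) -leaves_relabel es (perm_size sn) size_enum_ord.
subst m; pose sigma := perm inj_h.
have act (r r0 : tree S 'I_n) : relabel h r0 = r -> r0 = relabel (sigma^-1)%g r.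
  move=> <-; rewrite relabel_comp [RHS]relabel_id // => i _ /=.
  by rewrite -(permE inj_h) permK.
have [_ symM _] := idealM; have := symM n sigma chi c _ Mst.
rewrite /sym_act /relabel_elt fgliftB !fgliftU -(act _ _ es) -(act _ _ et).
rewrite (_ : perm_colouring _ _ = [ffun i => chi (h i)]) //.
by apply/ffunP => i; rewrite !ffunE permE.
Qed.

Lemma ideal_of_eqv n (chi : {ffun 'I_n -> I}) c (s t : tree S 'I_n) :
  perm_eq (leaves s) (enum 'I_n) -> eqv M chi c s t -> M chi c (<< s >> - << t >>).
Proof.
move=> sn [_ _ _ E]; have U : uniq (leaves s) by rewrite (perm_uniq sn) enum_uniq.
have := E U n id s t sn; rewrite !(relabel_id (f := id)) // => /(_ erefl erefl).
by rewrite (_ : [ffun i => _] = chi) //; apply/ffunP => i; rewrite ffunE.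
Qed.

End Substitution.

(** * Normal forms in ICom *)

Section SymNormalForm.
Variables (K : fieldType) (M : Defs.family K icom_sig).
Hypothesis idealM : is_sym_ideal M.
Hypothesis relM : forall n chi c f,
  @alpha_symmetry K n chi c f \/ icom_relation chi c f -> M chi c f.
Variables (X : eqType) (chi : X -> colour).

Local Notation alpha s t := (Node (OpAlpha : icom_sig) [:: s; t]).
Local Notation i_ s := (Node (OpI : icom_sig) [:: s]).
Local Notation r s t := (Node (OpR : icom_sig) [:: s; t]).
Local Notation y1 := (@Ordinal 2 0 isT).
Local Notation y2 := (@Ordinal 2 1 isT).
Implicit Types (a b e : tree icom_sig X) (x y z : X) (L : seq X).
Local Notation wc := (well_coloured chi).
Local Notation "a ~ b :> c" := (eqv M chi c a b)
  (at level 70, b at next level, c at next level).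

(** The outer tree is the bare generator over ['I_2], congruent to itself; the arguments enter by
    grafting. *)
Lemma eqv_alpha a a' b b' : a ~ a' :> A -> b ~ b' :> A ->
  alpha a b ~ alpha a' b' :> A.
Proof.
move=> Ea Eb.
have W : well_coloured (@all_A 2) (alpha (Leaf y1) (Leaf y2)) A by rewrite /= !ffunE.
refine (eqv_graft idealM icom_inputs_neq0 (psi := chi)
  (f := fun k : 'I_2 => nth a [:: a; b] k)
  (f' := fun k : 'I_2 => nth a [:: a'; b'] k) (eqv_refl idealM W) _).
by move=> k; rewrite /= !inE => /orP[]/eqP ->; rewrite ffunE.
Qed.

Lemma eqv_r a a' b b' : a ~ a' :> J -> b ~ b' :> A -> r a b ~ r a' b' :> J.
Proof.
move=> Ea Eb.
have W : well_coloured (@first_J 2) (r (Leaf y1) (Leaf y2)) J by rewrite /= !ffunE.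
refine (eqv_graft idealM icom_inputs_neq0 (psi := chi)
  (f := fun k : 'I_2 => nth a [:: a; b] k)
  (f' := fun k : 'I_2 => nth a [:: a'; b'] k) (eqv_refl idealM W) _).
by move=> k; rewrite /= !inE => /orP[]/eqP ->; rewrite ffunE.
Qed.

Lemma eqv_i a a' : a ~ a' :> J -> i_ a ~ i_ a' :> A.
Proof.
move=> Ea; have W : well_coloured (fun=> J) (i_ (Leaf tt)) A by [].
exact: (eqv_graft idealM icom_inputs_neq0 (f := fun=> a) (f' := fun=> a')
  (eqv_refl idealM W)).
Qed.

(** Turns a relation between formal inputs into one between arbitrary arguments [tau], over any
    label type. *)
Lemma eqv_relation n (chi0 : {ffun 'I_n -> colour}) c s t (tau : 'I_n -> tree _ X) :
  @alpha_symmetry K n chi0 c (<< s >> - << t >>) \/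
  icom_relation chi0 c (<< s >> - << t >> : elt K _ n) ->
  sym_monomial chi0 c s -> sym_monomial chi0 c t ->
  (forall k, wc (tau k) (chi0 k)) ->
  graft tau s ~ graft tau t :> c.
Proof.
move=> R ms mt wtau; apply: (eqv_graft idealM icom_inputs_neq0).
  by apply: (eqv_of_ideal idealM ms mt); apply: relM.
by move=> k _; apply: eqv_refl.
Qed.

Lemma eqv_alphaC a b : wc a A -> wc b A -> alpha a b ~ alpha b a :> A.
Proof.
move=> wa wb.
refine (eqv_relation (tau := fun k : 'I_2 => nth a [:: a; b] k)
  (or_introl (alpha_sym K)) _ _ _).
- by rewrite /sym_monomial ?enum_ord2 ?enum_ord3 /= ?ffunE.
- by rewrite /sym_monomial ?enum_ord2 ?enum_ord3 /= ?ffunE.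
- by case=> [] [|[|//]] //= ?; rewrite ffunE.
Qed.

Lemma eqv_alphaAC a b e : wc a A -> wc b A -> wc e A ->
  alpha (alpha a b) e ~ alpha (alpha a e) b :> A.
Proof.
move=> w0 w1 w2.
refine (eqv_relation (tau := fun k : 'I_3 => nth a [:: a; b; e] k)
  (or_intror (rel_alpha_comm K)) _ _ _).
- by rewrite /sym_monomial ?enum_ord2 ?enum_ord3 /= ?ffunE.
- by rewrite /sym_monomial ?enum_ord2 ?enum_ord3 /= ?ffunE.
- by case=> [] [|[|[|//]]] //= ?; rewrite ffunE.
Qed.

Lemma eqv_alphaA_swap a b e : wc a A -> wc b A -> wc e A ->
  alpha (alpha a e) b ~ alpha a (alpha b e) :> A.
Proof.
move=> w0 w1 w2.
refine (eqv_relation (tau := fun k : 'I_3 => nth a [:: a; b; e] k)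
  (or_intror (rel_alpha_assoc K)) _ _ _).
- by rewrite /sym_monomial ?enum_ord2 ?enum_ord3 /= ?ffunE.
- by rewrite /sym_monomial ?enum_ord2 ?enum_ord3 /= ?ffunE.
- by case=> [] [|[|[|//]]] //= ?; rewrite ffunE.
Qed.

Lemma eqv_rAC a b e : wc a J -> wc b A -> wc e A ->
  r (r a b) e ~ r (r a e) b :> J.
Proof.
move=> w0 w1 w2.
refine (eqv_relation (tau := fun k : 'I_3 => nth a [:: a; b; e] k)
  (or_intror (rel_r_comm K)) _ _ _).
- by rewrite /sym_monomial ?enum_ord2 ?enum_ord3 /= ?ffunE.
- by rewrite /sym_monomial ?enum_ord2 ?enum_ord3 /= ?ffunE.
- by case=> [] [|[|[|//]]] //= ?; rewrite ffunE.
Qed.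

Lemma eqv_rA_swap a b e : wc a J -> wc b A -> wc e A ->
  r (r a e) b ~ r a (alpha b e) :> J.
Proof.
move=> w0 w1 w2.
refine (eqv_relation (tau := fun k : 'I_3 => nth a [:: a; b; e] k)
  (or_intror (rel_r_assoc K)) _ _ _).
- by rewrite /sym_monomial ?enum_ord2 ?enum_ord3 /= ?ffunE.
- by rewrite /sym_monomial ?enum_ord2 ?enum_ord3 /= ?ffunE.
- by case=> [] [|[|[|//]]] //= ?; rewrite ffunE.
Qed.

Lemma eqv_alpha_i a b : wc a J -> wc b A ->
  alpha (i_ a) b ~ i_ (r a b) :> A.
Proof.
move=> w0 w1.
refine (eqv_relation (tau := fun k : 'I_2 => nth a [:: a; b] k)
  (or_intror (rel_alpha_i K)) _ _ _).
- by rewrite /sym_monomial ?enum_ord2 ?enum_ord3 /= ?ffunE.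
- by rewrite /sym_monomial ?enum_ord2 ?enum_ord3 /= ?ffunE.
- by case=> [] [|[|//]] //= ?; rewrite ffunE.
Qed.

Lemma eqv_r_i a b : wc a J -> wc b J ->
  r a (i_ b) ~ r b (i_ a) :> J.
Proof.
move=> w0 w1.
refine (eqv_relation (tau := fun k : 'I_2 => nth a [:: a; b] k)
  (or_intror (rel_r_i K)) _ _ _).
- by rewrite /sym_monomial ?enum_ord2 ?enum_ord3 /= ?ffunE.
- by rewrite /sym_monomial ?enum_ord2 ?enum_ord3 /= ?ffunE.
- by case=> [] [|[|//]] //= ?; rewrite ffunE.
Qed.

Lemma eqv_alphaA a b e : wc a A -> wc b A -> wc e A ->
  alpha (alpha a b) e ~ alpha a (alpha b e) :> A.
Proof.
move=> wa wb we; apply: (eqv_trans idealM (eqv_alphaAC wa wb we)).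
exact: eqv_alphaA_swap.
Qed.

Lemma eqv_rA a b e : wc a J -> wc b A -> wc e A ->
  r (r a b) e ~ r a (alpha b e) :> J.
Proof.
move=> wa wb we; apply: (eqv_trans idealM (eqv_rAC wa wb we)).
exact: eqv_rA_swap.
Qed.

Definition sym_leaf x : tree icom_sig X :=
  if chi x is A then Leaf x else i_ (Leaf x).

Fixpoint combA x L : tree icom_sig X :=
  if L is y :: L' then alpha (sym_leaf x) (combA y L') else sym_leaf x.

Definition combJ x L : tree icom_sig X :=
  if L is y :: L' then r (Leaf x) (combA y L') else Leaf x.

Lemma wc_sym_leaf x : wc (sym_leaf x) A.
Proof. by rewrite /sym_leaf; case ex : (chi x); rewrite /= ex. Qed.

Lemma wc_combA x L : wc (combA x L) A.
Proof.
by elim: L x => [|y L IH] x /=; rewrite wc_sym_leaf // IH.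
Qed.

Lemma wc_combJ x L : chi x = J -> wc (combJ x L) J.
Proof. by case: L => [|y L] /= ->; rewrite ?wc_combA. Qed.

Lemma leaves_combA x L : leaves (combA x L) = x :: L.
Proof.
have lx y : leaves (sym_leaf y) = [:: y] by rewrite /sym_leaf; case: (chi y).
by elim: L x => [|y L IH] x /=; rewrite ?lx ?IH ?cats0.
Qed.

Lemma leaves_combJ x L : leaves (combJ x L) = x :: L.
Proof. by case: L => [|y L] //=; rewrite leaves_combA cats0. Qed.

Local Hint Resolve wc_sym_leaf wc_combA : core.

Let refl c a : wc a c -> a ~ a :> c := eqv_refl idealM (t := a) (c := c).
Let trans c a2 a1 a3 : a1 ~ a2 :> c -> a2 ~ a3 :> c -> a1 ~ a3 :> c :=
  @eqv_trans _ _ _ _ idealM _ _ c a2 a1 a3.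
Let sym c a b : a ~ b :> c -> b ~ a :> c :=
  @eqv_sym _ _ _ _ idealM _ _ c a b.

Lemma combA_cat x L y L' :
  alpha (combA x L) (combA y L') ~ combA x (L ++ y :: L') :> A.
Proof.
elim: L x => [|z L IH] x /=; first by apply: refl; rewrite /= wc_sym_leaf wc_combA.
apply: trans (eqv_alphaA _ _ _) _ => //.
by apply: eqv_alpha (IH z); apply: refl.
Qed.

Lemma combA_swap x y L : combA x (y :: L) ~ combA y (x :: L) :> A.
Proof.
case: L => [|z L] /=; first exact: eqv_alphaC.
apply: trans (sym (eqv_alphaA _ _ _)) _ => //.
apply: trans (eqv_alphaA _ _ _) => //.
by apply: eqv_alpha; [apply: eqv_alphaC|apply: refl].
Qed.

Lemma combA_rem x y L : y \in x :: L -> combA x L ~ combA y (rem y (x :: L)) :> A.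
Proof.
elim: L x => [|z L IH] x; first by rewrite inE => /eqP ->; rewrite /= eqxx; apply: refl.
rewrite inE eq_sym [rem _ _]/=; case: eqP => [-> _|_ /= /IH E].
  by apply: refl; rewrite /= wc_sym_leaf wc_combA.
apply: (trans (eqv_alpha (refl (wc_sym_leaf x)) E)).
exact: combA_swap.
Qed.

(** The wanted head is moved to the front, and the rest is a shorter comb. Induction is on the size
    because this rest, [rem y (x :: L)], need not be a tail of the list. *)
Lemma combA_perm x L y L' : perm_eq (x :: L) (y :: L') -> combA x L ~ combA y L' :> A.
Proof.
have [n] := ubnP (size L); elim: n x L y L' => // n IH x L y L'.
rewrite ltnS => Ln p.
have yL : y \in x :: L by rewrite (perm_mem p) mem_head.
apply: trans (combA_rem yL) _.
have : perm_eq (rem y (x :: L)) L'.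
  by rewrite -(perm_cons y) -(permPl (perm_to_rem yL)).
have := size_rem yL; case: (rem y (x :: L)) => [|z R] /= sR pR.
  by move/perm_size: (pR); case: (L') => // _; apply: refl.
case: L' p pR => [|z' R'] p pR; first by have := perm_size pR.
apply: eqv_alpha; first exact: refl.
by apply: IH => //; rewrite sR.
Qed.

Lemma combJ_perm_tail x L L' : chi x = J -> perm_eq L L' ->
  combJ x L ~ combJ x L' :> J.
Proof.
move=> xJ; have wx : wc (Leaf x) J by rewrite /= xJ.
case: L L' => [|y L] [|y' L'] p; first exact: refl.
- by have := perm_size p.
- by have := perm_size p.
- by apply: eqv_r; [apply: refl|apply: combA_perm].
Qed.

(** Here [r(x, alpha(i y, c))] becomes [r(r(x, i y), c)], where the last relation exchanges [x] and
    [y]. *)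
Lemma combJ_swap x y L : chi x = J -> chi y = J ->
  combJ x (y :: L) ~ combJ y (x :: L) :> J.
Proof.
move=> xJ yJ; have wx : wc (Leaf x) J by rewrite /= xJ.
have wy : wc (Leaf y) J by rewrite /= yJ.
case: L => [|z L] /=; rewrite /sym_leaf xJ yJ; first exact: eqv_r_i.
have ix : wc (i_ (Leaf x)) A by rewrite /= xJ.
have iy : wc (i_ (Leaf y)) A by rewrite /= yJ.
apply: trans (sym (eqv_rA _ _ _)) _ => //.
apply: trans (eqv_rA _ _ _) => //.
by apply: eqv_r; [apply: eqv_r_i|apply: refl].
Qed.

Lemma combJ_perm x L y L' : chi x = J -> chi y = J ->
  perm_eq (x :: L) (y :: L') -> combJ x L ~ combJ y L' :> J.
Proof.
move=> xJ yJ p; have [exy|xy] := eqVneq x y.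
  by subst y; apply: combJ_perm_tail => //; rewrite -(perm_cons x).
have yL : y \in L.
  by have := perm_mem p y; rewrite !inE eqxx eq_sym (negPf xy).
apply: (trans (combJ_perm_tail xJ (perm_to_rem yL))).
apply: (trans (combJ_swap _ xJ yJ)); apply: combJ_perm_tail => //.
rewrite -(perm_cons y); apply: perm_trans p.
rewrite (perm_catCA [:: y] [:: x] (rem y L)) perm_cons perm_sym.
exact: perm_to_rem.
Qed.

(** Once the children are combs, associativity concatenates them. The head of a [J]-comb is not
    determined by [t]; the freedom is removed afterwards by [combJ_perm]. *)
Lemma sym_normal_form c (t : tree icom_sig X) : wc t c ->
  match c with
  | A => exists x L, t ~ combA x L :> A
  | J => exists x L, chi x = J /\ t ~ combJ x L :> J
  end.
Proof.
elim: t c => [x|g ts IH] c.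
  move=> /= /eqP <-; case ex: (chi x).
    by exists x, [::]; rewrite /= /sym_leaf ex; apply: refl; rewrite /= ex.
  by exists x, [::]; split=> //; apply: refl; rewrite /= ex.
case: g => /= /andP[/eqP <-];
  case: ts IH => [|s [|u [|? ?]]] //=; rewrite ?andbF ?andbT //.
- move=> [IHs [IHu _]] /andP[/IHs[x [L Es]] /IHu[y [L' Eu]]].
  exists x, (L ++ y :: L'); apply: trans (eqv_alpha Es Eu) _.
  exact: combA_cat.
- move=> [IHs _] /IHs[x [L [xJ Es]]]; have wx : wc (Leaf x) J by rewrite /= xJ.
  exists x, L; apply: trans (eqv_i Es) _; case: L {Es} => [|y L] /=.
    by rewrite /sym_leaf xJ; apply: refl; rewrite /= xJ.
  (* An [i] above [r] is pushed down to the head leaf, turning [r] into [alpha]. *)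
  by rewrite /sym_leaf xJ; apply/sym/eqv_alpha_i.
- move=> [IHs [IHu _]] /andP[/IHs[x [L [xJ Es]]] /IHu[y [L' Eu]]].
  have wx : wc (Leaf x) J by rewrite /= xJ.
  exists x, (L ++ y :: L'); split=> //; apply: trans (eqv_r Es Eu) _.
  case: L {Es} => [|z L] /=; first by apply: refl; rewrite /= xJ wc_combA.
  apply: trans (eqv_rA _ _ _) _ => //.
  by apply: eqv_r; [apply: refl|apply: combA_cat].
Qed.

End SymNormalForm.

(** * Dimensions and generating series *)

Section Dimensions.
Variable K : fieldType.

(** Stated for every ideal [M] containing the relations, since this is what membership in
    [icom_ideal] unfolds to. Congruence preserves leaves, so the combs of [s] and [t] have the same
    labels. *)
Lemma sym_monomial_eqv (M : Defs.family K icom_sig) n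
    (chi : {ffun 'I_n -> colour}) (c : colour) (s t : tree icom_sig 'I_n) :
  is_sym_ideal M ->
  (forall m psi d f,
     @alpha_symmetry K m psi d f \/ icom_relation psi d f -> M m psi d f) ->
  sym_monomial chi c s -> sym_monomial chi c t -> M n chi c (<< s >> - << t >>).
Proof.
move=> idealM relM /andP[ws sn] /andP[wt tn].
apply: ideal_of_eqv (sn) _.
have st : perm_eq (leaves s) (leaves t) by rewrite (perm_trans sn) // perm_sym.
have := sym_normal_form idealM relM wt; have := sym_normal_form idealM relM ws.
case: c {ws wt} => [[x [L Es]] [y [L' Et]]|[x [L [xJ Es]]] [y [L' [yJ Et]]]].
  apply: (eqv_trans idealM Es); apply: (eqv_trans idealM _ (eqv_sym idealM Et)).
  apply: combA_perm => //; have [_ _ ps _] := Es; have [_ _ pt _] := Et.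
  rewrite -(leaves_combA chi x L) -(leaves_combA chi y L').
  by rewrite -(permPl ps) -(permPr pt).
apply: (eqv_trans idealM Es); apply: (eqv_trans idealM _ (eqv_sym idealM Et)).
apply: combJ_perm => //; have [_ _ ps _] := Es; have [_ _ pt _] := Et.
rewrite -(leaves_combJ chi x L) -(leaves_combJ chi y L').
by rewrite -(permPl ps) -(permPr pt).
Qed.

Lemma icom_dim1 n (chi : {ffun 'I_n -> colour}) c (t : tree icom_sig 'I_n) :
  sym_monomial chi c t -> icom_dim K chi c 1.
Proof.
move=> mt; exists (fun=> << t >>); split=> [_|f /allP mf|a Wa i].
- by rewrite /free_sym all_domU.
(* All monomials being congruent to [t], an element is congruent to its coefficient sum times
   [t]. *)
- exists (fun=> coeff_sum f) => M idealM relM.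
  rewrite big_ord1 coeff_sum_sub // big_seq; elim/big_ind: _ => [|g h|s sf].
  + exact: ideal0.
  + exact: idealD.
  + by apply: (idealZ idealM); apply: (sym_monomial_eqv idealM relM _ mt); exact: mf.
have [_] := icom_ideal_zero_sum Wa.
by rewrite big_ord1 linearZ /= coeff_sumU [LHS]mulr1 (ord1 i).
Qed.

Lemma icom_dim0 n (chi : {ffun 'I_n -> colour}) c :
  (forall t : tree icom_sig 'I_n, ~~ sym_monomial chi c t) -> icom_dim K chi c 0.
Proof.
move=> no_mon; exists (fun=> 0); split=> [i|f mf|a _ []//].
  exact: all_dom0.
exists (fun=> 0) => M idealM _; rewrite big_ord0 subr0.
by rewrite (all_dom_eq0 no_mon mf); apply: ideal0.
Qed.

(** Only [r] has output [J], and its first input has colour [J] again: follow first children up to a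
    leaf. *)
Lemma exists_J_leaf (X : eqType) (chi : X -> colour) (t : tree icom_sig X) :
  well_coloured chi t J -> exists2 x, x \in leaves t & chi x = J.
Proof.
elim: t => [x /= /eqP|g ts IH]; first by exists x; rewrite ?inE.
case: g => //=; case: ts IH => [|s [|u [|? ?]]] //=; rewrite ?andbF //.
move=> [IHs _] /andP[/IHs[x xs xJ] _]; exists x => //.
by rewrite mem_cat xs.
Qed.

Lemma icom_dim_A n (chi : {ffun 'I_n -> colour}) : icom_dim K chi A (0 < n).
Proof.
case: n chi => [|n] chi.
  apply: icom_dim0 => t; apply/negP => /andP[wt tn].
  have := size_leaves_gt0 icom_inputs_neq0 wt.
  by rewrite (perm_size tn) size_enum_ord.
have := size_enum_ord n.+1; case en : (enum 'I_n.+1) => [//|x L] _.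
apply: (icom_dim1 (t := combA chi x L)).
by rewrite /sym_monomial wc_combA leaves_combA en perm_refl.
Qed.

Lemma icom_dim_J n (chi : {ffun 'I_n -> colour}) :
  icom_dim K chi J (0 < #|[set k | chi k == J]|)%N.
Proof.
case: (posnP #|[set k | chi k == J]|) => [/eqP|/card_gt0P[k]].
  rewrite cards_eq0 => /eqP noJ; apply: icom_dim0 => t; apply/negP => /andP[wt _].
  have [x _ xJ] := exists_J_leaf wt.
  by move/setP: noJ => /(_ x); rewrite !inE xJ.
rewrite inE => /eqP kJ.
apply: (icom_dim1 (t := combJ chi k (rem k (enum 'I_n)))).
by rewrite /sym_monomial wc_combJ // leaves_combJ perm_sym perm_to_rem ?mem_enum.
Qed.

End Dimensions.

(** * Coefficients of the exponential series *)

Section GeneratingSeries.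

Lemma coef_t1_t2 i j m1 m2 :
  (t1 ^+ i * t2 ^+ j)`_m2`_m1 = ((m1 == i) && (m2 == j))%:R.
Proof.
rewrite /t1 /t2 -rmorphXn coefCM coefXn.
by case: (m2 == j); rewrite ?mulr1 ?mulr0 ?coef0 ?coefXn ?andbT ?andbF.
Qed.

(** By homogeneity only the power [m1 + m2] contributes, through one binomial term; the binomial
    coefficient over the factorial of [m1 + m2] is the claimed value. *)
Lemma fps_exp_t1_t2 m1 m2 : fps_exp (t1 + t2) m1 m2 = 1 / (m1`! * m2`!)%:R.
Proof.
rewrite /fps_exp /fps_of_poly (bigD1 ord_max) //= big1 ?addr0 => [|k kmax]; last first.
  rewrite exprDn !coef_sum big1 ?mul0r // => i _.
  rewrite !coefMn coef_t1_t2; case: andP => [[/eqP e1 /eqP e2]|_]; last by rewrite mul0rn.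
  by case/eqP: kmax; apply: val_inj => /=; have := ltn_ord i; lia.
have m2lt : (m2 < (m1 + m2).+1)%N by lia.
(* In [exprDn] the index is the exponent of the second summand [t2], hence [m2]. *)
rewrite exprDn !coef_sum (bigD1 (Ordinal m2lt)) //= big1 ?addr0 => [|i im2]; last first.
  rewrite !coefMn coef_t1_t2; case: andP => [[_ /eqP e2]|_]; last by rewrite mul0rn.
  by case/eqP: im2; apply: val_inj.
rewrite !coefMn coef_t1_t2 addnK !eqxx /=.
have /(congr1 (fun n => n%:R : rat)) := bin_fact (leq_addl m1 m2).
rewrite addnK natrM => <-.
have f0 (n : nat) : n`!%:R != 0 :> rat by rewrite Num.Theory.pnatr_eq0 -lt0n fact_gt0.
have b0 : 'C(m1 + m2, m2)%:R != 0 :> rat by rewrite Num.Theory.pnatr_eq0 -lt0n bin_gt0 leq_addl.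
by rewrite mulnC natrM; field; rewrite !f0 b0.
Qed.

Lemma fps_exp_t1 m1 m2 : fps_exp t1 m1 m2 = (m2 == 0)%:R / m1`!%:R.
Proof.
have coefE k : fps_of_poly (t1 ^+ k) m1 m2 = ((m1 == k) && (m2 == 0))%:R.
  by rewrite /fps_of_poly -(coef_t1_t2 k 0 m1 m2) expr0 mulr1.
have m1lt : (m1 < (m1 + m2).+1)%N by lia.
rewrite /fps_exp (bigD1 (Ordinal m1lt)) //= big1 ?addr0 => [|k kmax].
  by rewrite coefE eqxx.
rewrite coefE; case: eqP => [e1|_]; last by rewrite mul0r.
by case/eqP: kmax; apply: val_inj.
Qed.

Lemma fps_of_poly1 m1 m2 : fps_of_poly 1 m1 m2 = ((m1 == 0) && (m2 == 0))%:R.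
Proof. by rewrite -(coef_t1_t2 0 0) !expr0 mulr1. Qed.

Lemma card_colours n (chi : {ffun 'I_n -> colour}) :
  (#|[set k | chi k == A]| + #|[set k | chi k == J]|)%N = n.
Proof.
rewrite (_ : [set k | chi k == J] = ~: [set k | chi k == A]) ?cardsC ?card_ord //.
by apply/setP => k; rewrite !inE; case: (chi k).
Qed.

Variable K : fieldType.

Lemma icom_gen_series_A :
  has_gen_series (@icom_dim K) A (fps_sub (fps_exp (t1 + t2)) (fps_of_poly 1)).
Proof.
move=> n chi m1 m2; exists (0 < n)%N; first exact: icom_dim_A.
have := card_colours chi; rewrite -/m1 -/m2.
rewrite /fps_sub fps_exp_t1_t2 fps_of_poly1; case: n chi m1 m2 => [|n] chi m1 m2 mn.
  have /eqP := mn; rewrite addn_eq0 => /andP[/eqP -> /eqP ->] /=.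
  by rewrite mul0r muln1 divr1 subrr.
have /negPf -> : ~~ ((m1 == 0) && (m2 == 0)) by rewrite -addn_eq0 mn.
by rewrite subr0.
Qed.

Lemma icom_gen_series_J :
  has_gen_series (@icom_dim K) J (fps_sub (fps_exp (t1 + t2)) (fps_exp t1)).
Proof.
move=> n chi m1 m2; exists (0 < m2)%N; first exact: icom_dim_J.
rewrite /fps_sub fps_exp_t1_t2 fps_exp_t1 lt0n; case: (m2 =P 0) => [->|_] /=.
  by rewrite muln1 subrr mul0r.
by rewrite mul0r subr0.
Qed.

End GeneratingSeries.

Theorem theorem4p1 (K : fieldType) (charK : [pchar K] =i pred0) :
  [/\ is_quadratic (@shuffle_icom_relation K),
      is_groebner_basis shuffle_op_lt
        (@shuffle_icom_ideal K) (@shuffle_icom_relation K),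
      has_gen_series (@icom_dim K) A
        (fps_sub (fps_exp (t1 + t2)) (fps_of_poly 1)) &
      has_gen_series (@icom_dim K) J
        (fps_sub (fps_exp (t1 + t2)) (fps_exp t1))].
Proof.
split.
- exact: shuffle_icom_relation_quadratic.
- exact: shuffle_icom_groebner.
- exact: icom_gen_series_A.
- exact: icom_gen_series_J.
Qed.
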